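(* Let $\mathfrak{g}$ be a seven-dimensional real almost Abelian Lie algebra and $\mathfrak{u}$ a six-dimensional Abelian ideal of $\mathfrak{g}$. The following are equivalent: (i) $\mathfrak{g}$ admits a calibrated $\mathrm{G}_2^*$-structure $\varphi$ such that $\mathfrak{u}$ has signature $(3,3)$ with respect to $g_\varphi$; (ii) for any $f_7\in\mathfrak{g}\setminus\mathfrak{u}$ there exist $A,B\in\mathfrak{sl}(3,\mathbb{R})$ and an ordered basis of $\mathfrak{u}$ with respect to which $\mathrm{ad}(f_7)|_{\mathfrak{u}}$ has matrix $\mathrm{diag}(A,B)$; (iii) for any $f_7\in\mathfrak{g}\setminus\mathfrak{u}$, the complex Jordan normal form of $\mathrm{ad}(f_7)|_{\mathfrak{u}}$ is, up to permutation of the Jordan blocks, $\mathrm{diag}(J_1,J_2)$ for trace-free matrices $J_1,J_2\in\mathbb{C}^{3\times3}$ each of which is the complex Jordan normal form of a real $3\times3$ matrix.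
   Context: A $\mathrm{G}_2^*$-structure on a seven-dimensional real vector space $V$ is a three-form $\varphi$ with $f^*\varphi_1=\varphi$ for some linear isomorphism $f:V\to\mathbb{R}^7$, where $\varphi_1:=-(e^{127}+e^{347})+e^{567}+e^{135}-e^{146}-e^{236}-e^{245}$ ($e^{ijk}=e^i\wedge e^j\wedge e^k$); it induces a pseudo-Euclidean metric $g_\varphi$ of signature $(3,4)$, determined by $g_\varphi(v,w)\,\mathrm{vol}=\frac16(v\lrcorner\varphi)\wedge(w\lrcorner\varphi)\wedge\varphi$, for which $f^{-1}(e_1),\dots,f^{-1}(e_7)$ is orthonormal with $g_\varphi(f^{-1}e_i,f^{-1}e_i)=-1$ for $i\le4$, $+1$ for $i\ge5$. For a Lie algebra $\mathfrak{g}$, $d$ on $\Lambda^\bullet\mathfrak{g}^*$ is the derivation with $(d\alpha)(X,Y)=-\alpha([X,Y])$ for $\alpha\in\mathfrak{g}^*$; $\varphi$ is calibrated if $d\varphi=0$. A Lie algebra is almost Abelian if it has a codimension-one Abelian ideal. *)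

(* Defs.v *)
(* Real numbers are modelled as the real elements (Num.real)
   of an arbitrary numClosedFieldType C (e.g. C = complex numbers). *)
From HB Require Import structures.
From mathcomp Require Import all_boot all_order all_algebra.
Set Implicit Arguments. Unset Strict Implicit. Unset Printing Implicit Defensive.
Import Order.TTheory GRing.Theory Num.Theory.
Local Open Scope ring_scope.

Section G2star.
Variable C : numClosedFieldType.
Local Notation vec := 'rV[C]_7.

Definition realmx m n (A : 'M[C]_(m, n)) : Prop := forall i j, A i j \is Num.real.

Definition bracket (c : 'I_7 -> 'I_7 -> vec) (x y : vec) : vec :=
  \sum_(i < 7) \sum_(j < 7) (x 0 i * y 0 j) *: c i j.

Definition is_real_lie_algebra (c : 'I_7 -> 'I_7 -> vec) : Prop :=
  (forall i j, realmx (c i j)) /\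
  (forall x, realmx x -> bracket c x x = 0) /\
  (forall x y z, realmx x -> realmx y -> realmx z ->
     bracket c x (bracket c y z) + bracket c y (bracket c z x)
       + bracket c z (bracket c x y) = 0).

Definition in_span m (B : 'M[C]_(m, 7)) (x : vec) : Prop :=
  exists a : 'rV[C]_m, realmx a /\ x = a *m B.

Definition is_abelian_ideal6 (c : 'I_7 -> 'I_7 -> vec) (U : 'M[C]_(6, 7)) : Prop :=
  [/\ realmx U, \rank U = 6%N,
      (forall x y, realmx x -> in_span U y -> in_span U (bracket c x y))
    & (forall x y, in_span U x -> in_span U y -> bracket c x y = 0)].

Definition ordered_basis_of (U B : 'M[C]_(6, 7)) : Prop :=
  exists P : 'M[C]_6, [/\ realmx P, P \in unitmx & B = P *m U].

Definition mx_wrt (B : 'M[C]_(6, 7)) (F : vec -> vec) (M : 'M[C]_6) : Prop :=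
  forall k : 'I_6, F (row k B) = \sum_(l < 6) M l k *: row l B.

Definition ix (n : nat) : 'I_7 := inord n.-1.

(* e^{ijk} (1-based indices) evaluated on (a, b, d) *)
Definition e3 (i j k : nat) (a b d : vec) : C :=
  \det (\matrix_(r < 3, s < 3)
          (tnth [tuple a; b; d] r) 0 (tnth [tuple ix i; ix j; ix k] s)).

Definition phi1 (a b d : vec) : C :=
  - (e3 1 2 7 a b d + e3 3 4 7 a b d) + e3 5 6 7 a b d + e3 1 3 5 a b d
  - e3 1 4 6 a b d - e3 2 3 6 a b d - e3 2 4 5 a b d.

Definition phiF (F : 'M[C]_7) (x y z : vec) : C :=
  phi1 (x *m F) (y *m F) (z *m F).

(* the metric g_phi: f^{-1}(e_i) orthonormal, norms -1 (i <= 4), +1 (i >= 5) *)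
Definition eta7 (a b : vec) : C :=
  \sum_(i < 7) (if (i < 4)%N then -1 else 1) * a 0 i * b 0 i.

Definition gF (F : 'M[C]_7) (x y : vec) : C := eta7 (x *m F) (y *m F).

(* Chevalley-Eilenberg differential of a 3-form, with (d a)(X,Y) = - a([X,Y]) *)
Definition d3 (c : 'I_7 -> 'I_7 -> vec) (phi : vec -> vec -> vec -> C)
  (x0 x1 x2 x3 : vec) : C :=
  - phi (bracket c x0 x1) x2 x3 + phi (bracket c x0 x2) x1 x3
  - phi (bracket c x0 x3) x1 x2 - phi (bracket c x1 x2) x0 x3
  + phi (bracket c x1 x3) x0 x2 - phi (bracket c x2 x3) x0 x1.

Definition cond_i (c : 'I_7 -> 'I_7 -> vec) (U : 'M[C]_(6, 7)) : Prop :=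
  exists F : 'M[C]_7,
    [/\ realmx F, F \in unitmx,
        (forall x0 x1 x2 x3, realmx x0 -> realmx x1 -> realmx x2 -> realmx x3 ->
           d3 c (phiF F) x0 x1 x2 x3 = 0)
      & exists B, ordered_basis_of U B /\
          forall k l : 'I_6, gF F (row k B) (row l B)
            = (if k == l then (if (k < 3)%N then -1 else 1) else 0)].

Definition sl3 (A : 'M[C]_3) : Prop := realmx A /\ \tr A = 0.

Definition cond_ii (c : 'I_7 -> 'I_7 -> vec) (U : 'M[C]_(6, 7)) : Prop :=
  forall f7 : vec, realmx f7 -> ~ in_span U f7 ->
    exists (A B : 'M[C]_3) (Bs : 'M[C]_(6, 7)),
      [/\ sl3 A, sl3 B, ordered_basis_of U Bs
        & mx_wrt Bs (bracket c f7) (block_mx A 0 0 B)].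

Definition jordan_mx n (J : 'M[C]_n) : Prop :=
  forall i j : 'I_n,
    ((j : nat) <> i -> (j : nat) <> i.+1 -> J i j = 0) /\
    ((j : nat) = i.+1 -> J i j = 0 \/ (J i j = 1 /\ J i i = J j j)).

Definition similar n (M N : 'M[C]_n) : Prop :=
  exists Q : 'M[C]_n, Q \in unitmx /\ Q *m M = N *m Q.

Definition is_jnf_of n (J M : 'M[C]_n) : Prop := jordan_mx J /\ similar M J.

Definition cond_iii (c : 'I_7 -> 'I_7 -> vec) (U : 'M[C]_(6, 7)) : Prop :=
  forall f7 : vec, realmx f7 -> ~ in_span U f7 ->
    forall M : 'M[C]_6, mx_wrt U (bracket c f7) M ->
    exists J1 J2 : 'M[C]_3,
      [/\ \tr J1 = 0, \tr J2 = 0,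
          (exists R1 : 'M[C]_3, realmx R1 /\ is_jnf_of J1 R1),
          (exists R2 : 'M[C]_3, realmx R2 /\ is_jnf_of J2 R2)
        & is_jnf_of (block_mx J1 0 0 J2) M].

End G2star.

(* Main.v *)
(* The restriction of [phi1] to the orthogonal of a vector [n] with [g n n = -1] is
   [rho = vol_+ + vol_-], the sum of two volume forms on the three-dimensional eigenspaces
   of the involution [x |-> n * x] (cross product).  For an almost Abelian algebra
   [d phi = 0] says that [D = ad f |_u] annihilates [phi|_u], and the annihilator of [rho]
   is [sl_3 + sl_3]; this gives (i) <-> (ii).  For (ii) <-> (iii), pass to Jordan forms
   blockwise, and use that real matrices similar over [C] are similar over the reals. *)
Require Import Defs.
From HB Require Import structures.
From mathcomp Require Import all_boot all_order all_algebra.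
From mathcomp Require Import ring.
Set Implicit Arguments. Unset Strict Implicit. Unset Printing Implicit Defensive.
Import Order.TTheory GRing.Theory Num.Theory.
Local Open Scope ring_scope.

(* MathComp has its own, different, [realmx] and [similar]. *)
Local Notation realmx := Defs.realmx.
Local Notation similar := Defs.similar.

(** * Real matrices *)

(** Signature (3,3) on the ideal forces a unit normal of norm -1, and this sign makes the cross
    product with it an involution instead of a complex structure, so that its eigenspaces are real.
    Their dimensions agree because the involution is skew for the metric. The matrix [D] need not
    respect the metric, so its block form has to come from the three-form alone: products that mix
    the two eigenspaces vanish, and the form is nondegenerate on each of them, which leaves no room
    for off-diagonal blocks. Nondegeneracy is tested on Pluecker relations.

    The scalars are those of a closed field, so reality has to be tracked. It is expressed as
    invariance under conjugation, which commutes with products, inverses, kernels and row bases;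
    choices made by elimination are then automatically real. Vectors are rows acted on from the
    right, whence the transposes. *)

Lemma realmxP (C : numClosedFieldType) m n (A : 'M[C]_(m, n)) :
  realmx A <-> map_mx Num.conj A = A.
Proof.
split=> [rA | cA i j]; last by apply/CrealP; rewrite -[in RHS]cA mxE.
by apply/matrixP=> i j; rewrite mxE; apply/CrealP/rA.
Qed.

Lemma realmxE (C : numClosedFieldType) m n (A : 'M[C]_(m, n)) :
  realmx A <-> A \is a mxOver Num.real.
Proof. by split=> [rA | /mxOverP//]; apply/mxOverP. Qed.

Lemma realmx_mul (C : numClosedFieldType) m n p (A : 'M[C]_(m, n)) (B : 'M_(n, p)) :
  realmx A -> realmx B -> realmx (A *m B).
Proof. by move=> /realmxP rA /realmxP rB; apply/realmxP; rewrite map_mxM rA rB. Qed.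

Lemma realmx_tr (C : numClosedFieldType) m n (A : 'M[C]_(m, n)) :
  realmx A -> realmx A^T.
Proof. by move=> rA i j; rewrite mxE. Qed.

Lemma realmx_inv (C : numClosedFieldType) n (A : 'M[C]_n) :
  realmx A -> realmx (invmx A).
Proof. by move=> /realmxP rA; apply/realmxP; rewrite map_invmx rA. Qed.

Lemma realmx_col (C : numClosedFieldType) m n p (A : 'M[C]_(m, p)) (B : 'M_(n, p)) :
  realmx A -> realmx B -> realmx (col_mx A B).
Proof. by move=> /realmxP rA /realmxP rB; apply/realmxP; rewrite map_col_mx rA rB. Qed.

Lemma realmx_block (C : numClosedFieldType) m1 m2 n1 n2 (A : 'M[C]_(m1, n1))
    (B : 'M_(m1, n2)) (D : 'M_(m2, n1)) (E : 'M_(m2, n2)) :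
  realmx (block_mx A B D E) -> realmx A /\ realmx E.
Proof.
move=> /realmxP; rewrite map_block_mx => /eq_block_mx[rA _ _ rE].
by split; apply/realmxP.
Qed.

Lemma realmx_free (C : numClosedFieldType) m n p (A : 'M[C]_(m, n)) (B : 'M_(n, p)) :
  row_free B -> realmx B -> realmx (A *m B) -> realmx A.
Proof.
move=> fB /realmxP rB /realmxP; rewrite map_mxM rB => /(row_free_inj fB) rA.
exact/realmxP.
Qed.

(** Elimination commutes with conjugation, so the row basis chosen for a conjugation-invariant
    matrix is itself invariant. *)
Lemma real_row_base (C : numClosedFieldType) m n r (A : 'M[C]_(m, n)) :
  realmx A -> \rank A = r -> exists2 B : 'M[C]_(r, n), realmx B & (B :=: A)%MS.
Proof.
move=> /realmxP rA <-; exists (row_base A); last exact: eq_row_base.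
apply/realmxP; rewrite map_row_base.
(* The proof inside the cast is generalised so that rewriting with [rA] leaves a cast along a
   trivial equality. *)
move: (mxrank_map _ _); rewrite rA => e.
by rewrite castmx_id.
Qed.

(** * Similarity *)

Lemma similar_sym (C : numClosedFieldType) n (M N : 'M[C]_n) :
  similar M N -> similar N M.
Proof.
move=> [Q [uQ e]]; exists (invmx Q); split; first by rewrite unitmx_inv.
by rewrite -[N](mulmxK uQ) -e !mulmxA mulVmx // mul1mx.
Qed.

Lemma similar_trans (C : numClosedFieldType) n (M N K : 'M[C]_n) :
  similar M N -> similar N K -> similar M K.
Proof.
move=> [Q [uQ e]] [R [uR f]]; exists (R *m Q); split; first by rewrite unitmx_mul uR.
by rewrite -mulmxA e mulmxA f mulmxA.
Qed.

Lemma similar_tr (C : numClosedFieldType) n (M N : 'M[C]_n) :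
  similar M N -> similar M^T N^T.
Proof.
move=> /similar_sym[Q [uQ e]]; exists Q^T; split; first by rewrite unitmx_tr.
by rewrite -!trmx_mul e.
Qed.

Lemma similar_mxtrace (C : numClosedFieldType) n (M N : 'M[C]_n) :
  similar M N -> \tr M = \tr N.
Proof.
move=> [Q [uQ e]]; rewrite -[M](mulKmx uQ) e mxtrace_mulC -mulmxA.
by rewrite mulmxV // mulmx1.
Qed.

Lemma similar_block (C : numClosedFieldType) m n (A A' : 'M[C]_m) (B B' : 'M_n) :
  similar A A' -> similar B B' ->
  similar (block_mx A 0 0 B) (block_mx A' 0 0 B').
Proof.
move=> [Q [uQ e]] [R [uR f]]; exists (block_mx Q 0 0 R); split.
  by rewrite unitmxE det_ublock unitrM -!unitmxE uQ.
by rewrite !mulmx_block !mulmx0 !mul0mx !addr0 !add0r e f.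
Qed.

Lemma similar_real (C : numClosedFieldType) n (M N : 'M[C]_n) :
  realmx M -> realmx N -> similar M N ->
  exists Q : 'M[C]_n, [/\ realmx Q, Q \in unitmx & Q *m M = N *m Q].
Proof.
move=> /realmxE rM /realmxE rN [Q [uQ e]].
have [|P] := real_similar (A := M) (B := N) _ rM rN.
  by exists Q => //; apply/similarP.
rewrite inE => /andP[/realmxE rP uP] /similarP PE.
by exists P; split=> //; apply: PE.
Qed.

(** * Jordan form of a 3 x 3 matrix *)

(** Entries are looked up in nested lists, so that case analysis on the indices reduces them by
    computation. *)
Definition mx3 (R : nzRingType) (a b c d e f g h i : R) : 'M[R]_3 :=
  \matrix_(r, s) nth 0 (nth [::] [:: [:: a; b; c]; [:: d; e; f]; [:: g; h; i]] r) s.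

Lemma mx3E (R : nzRingType) (A : 'M[R]_3) :
  exists a b c d e f g h i, A = mx3 a b c d e f g h i.
Proof.
exists (A 0 0), (A 0 1), (A 0 2%:R), (A 1 0), (A 1 1), (A 1 2%:R),
  (A 2%:R 0), (A 2%:R 1), (A 2%:R 2%:R).
by apply/matrixP=> -[[|[|[|//]]] ?] [[|[|[|//]]] ?]; rewrite mxE /=; congr (A _ _); apply: val_inj.
Qed.

Lemma mx3M (R : nzRingType) (a b c d e f g h i a' b' c' d' e' f' g' h' i' : R) :
  mx3 a b c d e f g h i *m mx3 a' b' c' d' e' f' g' h' i' =
  mx3 (a * a' + b * d' + c * g') (a * b' + b * e' + c * h') (a * c' + b * f' + c * i')
      (d * a' + e * d' + f * g') (d * b' + e * e' + f * h') (d * c' + e * f' + f * i')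
      (g * a' + h * d' + i * g') (g * b' + h * e' + i * h') (g * c' + h * f' + i * i').
Proof.
by apply/matrixP=> -[[|[|[|//]]] ?] [[|[|[|//]]] ?];
  rewrite !mxE !big_ord_recl big_ord0 !mxE /= addr0 addrA.
Qed.

Lemma mx3_det (R : comNzRingType) (a b c d e f g h i : R) :
  \det (mx3 a b c d e f g h i) =
  a * e * i + b * f * g + c * d * h - c * e * g - b * d * i - a * f * h.
Proof.
rewrite (expand_det_row _ 0) !big_ord_recl big_ord0 /cofactor /=.
rewrite !(expand_det_row _ 0) !big_ord_recl !big_ord0 /cofactor !det_mx11 !mxE /=.
by rewrite !(addn0, add0n, addn1, expr0, expr1, expr2, exprS); ring.
Qed.

Lemma jordan_mx3 (C : numClosedFieldType) (a b c s t : C) :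
  (s = 0 \/ s = 1 /\ a = b) -> (t = 0 \/ t = 1 /\ b = c) ->
  jordan_mx (mx3 a s 0 0 b t 0 0 c).
Proof.
by move=> Hs Ht [[|[|[|//]]] ?] [[|[|[|//]]] ?]; split=> //=; rewrite !mxE.
Qed.

Lemma jordan_exists_triu (C : numClosedFieldType) (a b c x y z : C) :
  exists J : 'M[C]_3, is_jnf_of J (mx3 a x y 0 b z 0 0 c).
Proof.
(* The rows of the base change are generalized left eigenvectors. *)
have use a' b' c' s t q1 q2 q3 q4 q5 q6 q7 q8 q9 :
    (s = 0 \/ s = 1 /\ a' = b') -> (t = 0 \/ t = 1 /\ b' = c') ->
    q1 * q5 * q9 + q2 * q6 * q7 + q3 * q4 * q8 - q3 * q5 * q7 - q2 * q4 * q9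
      - q1 * q6 * q8 != 0 ->
    mx3 q1 q2 q3 q4 q5 q6 q7 q8 q9 *m mx3 a x y 0 b z 0 0 c
      = mx3 a' s 0 0 b' t 0 0 c' *m mx3 q1 q2 q3 q4 q5 q6 q7 q8 q9 ->
    exists J : 'M[C]_3, is_jnf_of J (mx3 a x y 0 b z 0 0 c).
  move=> Hs Ht nz e; exists (mx3 a' s 0 0 b' t 0 0 c'); split; first exact: jordan_mx3.
  by exists (mx3 q1 q2 q3 q4 q5 q6 q7 q8 q9); rewrite unitmxE mx3_det unitfE.

have fin q1 q2 q3 q4 q5 q6 q7 q8 q9 a' b' c' s t :
   [/\ q1 * a = a' * q1 + s * q4, q1 * x + q2 * b = a' * q2 + s * q5,
       q1 * y + q2 * z + q3 * c = a' * q3 + s * q6, q4 * a = b' * q4 + t * q7 &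
       q4 * x + q5 * b = b' * q5 + t * q8] ->
   [/\ q4 * y + q5 * z + q6 * c = b' * q6 + t * q9, q7 * a = c' * q7,
       q7 * x + q8 * b = c' * q8 & q7 * y + q8 * z + q9 * c = c' * q9] ->
   mx3 q1 q2 q3 q4 q5 q6 q7 q8 q9 *m mx3 a x y 0 b z 0 0 c
     = mx3 a' s 0 0 b' t 0 0 c' *m mx3 q1 q2 q3 q4 q5 q6 q7 q8 q9.
  move=> [e1 e2 e3 e4 e5] [e6 e7 e8 e9]; rewrite !mx3M.
  by rewrite !(mulr0, mul0r, addr0, add0r) e1 e2 e3 e4 e5 e6 e7 e8 e9.
(* [k] scales a coupling [w] to a legal superdiagonal entry. *)
have sup (w : C) : exists k : C, k != 0 /\ (k * w = 0 \/ k * w = 1).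
  have [->|w0] := eqVneq w 0; first by exists 1; rewrite oner_eq0 mulr0; auto.
  by exists w^-1; rewrite invr_eq0 mulVf //; auto.
have supE (s : C) u : s = 0 \/ s = 1 -> s = 0 \/ s = 1 /\ u = u :> C.
  by case; auto.
have N0 (u v : C) : u != v -> (u - v != 0) * (v - u != 0).
  by rewrite !subr_eq0 [v == u]eq_sym => ->.
have [ab|/N0 ab] := eqVneq a b; first subst b.
  have [ac|/N0 ac] := eqVneq a c; first subst c.
    (* For a triple eigenvalue the nilpotent part is classified by the vanishing of [x] and [z], and
       by [y] if both vanish. *)
    have [x0|x0] := eqVneq x 0; first subst x; have [z0|z0] := eqVneq z 0; first subst z.
    - have [k [k0 kw]] := sup y.
      apply: (use a a a (k * y) 0 k 0 0 0 0 1 0 1 0); [auto | auto | | apply: fin; split; ring].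
      by rewrite !(mulr0, mul0r, subr0, add0r, mulr1, sub0r) oppr_eq0.
    - apply: (use a a a 0 1 z (- y) 0 0 1 0 0 0 z); [auto | auto | | apply: fin; split; ring].
      by rewrite !(mulr0, mul0r, subr0, addr0, mulr1) mulf_neq0.
    - subst z; apply: (use a a a 1 0 1 0 0 0 x y 0 0 1); [auto | auto | | apply: fin; split; ring].
      by rewrite !(mulr0, mul0r, subr0, addr0, mulr1, mul1r).
    - apply: (use a a a 1 1 1 0 0 0 x y 0 0 (x * z)); [auto | auto | | apply: fin; split; ring].
      by rewrite !(mulr0, mul0r, subr0, addr0, mulr1, mul1r) !mulf_neq0.
  have [k [k0 kw]] := sup x.
  apply: (use a a c (k * x) 0 k 0 (k * (y - x * z / (a - c)) / (a - c))
              0 1 (z / (a - c)) 0 0 1); [auto | auto | | apply: fin; split; field; rewrite ?ac //].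
  by rewrite !(mulr0, mul0r, subr0, addr0, mulr1, mul1r).
have [ac|/N0 ac] := eqVneq a c; first subst c.
  (* This is the coupling of the two equal eigenvalues that survives once [b], between them on the
     diagonal, is split off. *)
  have [k [k0 kw]] := sup (y + x / (a - b) * z).
  apply: (use a a b (k * (y + x / (a - b) * z)) 0 k (k * (x / (a - b))) 0
              0 0 1 0 1 (z / (b - a))); [auto | auto | | apply: fin; split; field; rewrite ?ab //].
  by rewrite !(mulr0, mul0r, subr0, addr0, add0r, mulr1, mul1r, sub0r) oppr_eq0.
have [bc|/N0 bc] := eqVneq b c; first subst c.
  have [k [k0 kw]] := sup z.
  apply: (use a b b 0 (k * z) 1 (x / (a - b)) ((y + x / (a - b) * z) / (a - b))
              0 k 0 0 0 1); [auto | auto | | apply: fin; split; field; rewrite ?ab //].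
  by rewrite !(mulr0, mul0r, subr0, addr0, add0r, mulr1, mul1r).
apply: (use a b c 0 0 1 (x / (a - b)) ((y + x / (a - b) * z) / (a - c))
              0 1 (z / (b - c)) 0 0 1);
  [auto | auto | | apply: fin; split; field; rewrite ?ab ?bc ?ac //].
by rewrite !(mulr0, mul0r, subr0, addr0, add0r, mulr1, mul1r) oner_eq0.
Qed.

Lemma jordan_exists3 (C : numClosedFieldType) (A : 'M[C]_3) :
  exists J : 'M[C]_3, is_jnf_of J A.
Proof.

(* The Schur form is lower triangular; taking it of the transpose makes [T^T] upper triangular and
   similar to [A]. *)
have [P /unitarymx_unit uP] := Schur A^T isT.
rewrite /similar_to conjumx // => /is_trig_mxP trT.
set T := P *m A^T *m invmx P in trT.
have AT : similar A T^T.
  rewrite -[A]trmxK; apply: similar_tr; exists P.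
  by rewrite /T mulmxKV.
have [a [x [y [d [b [z [e [f [k TE]]]]]]]]] := mx3E T^T.
have T0 (i j : 'I_3) : (j < i)%N -> T^T i j = 0 by move=> ij; rewrite mxE trT.
have d0 := T0 1 0 isT; have e0 := T0 2%:R 0 isT; have f0 := T0 2%:R 1 isT.
rewrite TE !mxE /= in d0 e0 f0; rewrite {}d0 {}e0 {}f0 {T0} in TE.
have [J [jJ sJ]] := jordan_exists_triu a b k x y z.
by exists J; split=> //; apply: similar_trans AT _; rewrite TE.
Qed.

(** The superdiagonal entry at the junction of the two blocks is [0], which [jordan_mx] always
    permits. *)
Lemma jordan_block (C : numClosedFieldType) m n (A : 'M[C]_m) (B : 'M_n) :
  jordan_mx A -> jordan_mx B -> jordan_mx (block_mx A 0 0 B).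
Proof.
move=> jA jB i j; case: (split_ordP i) => i' ->; case: (split_ordP j) => j' ->;
  rewrite ?(block_mxEul, block_mxEur, block_mxEdl, block_mxEdr, mxE) /=; split; auto.
- by case: (jA i' j').
- by case: (jA i' j').
- by move=> ji jSi; case: (jB i' j') => + _; apply=> e; [apply: ji | apply: jSi];
    rewrite e ?addnS.
- rewrite -addnS => /addnI e; by case: (jB i' j') => _ /(_ e).
Qed.

(** * The action of a vector on the ideal *)

Section Action.
Variables (C : numClosedFieldType) (c : 'I_7 -> 'I_7 -> 'rV[C]_7).

Definition ad_mx (x : 'rV[C]_7) : 'M[C]_7 := \matrix_j (\sum_i x 0 i *: c i j).

Lemma bracketE x y : bracket c x y = y *m ad_mx x.
Proof.
rewrite mulmx_sum_row /bracket exchange_big /=; apply: eq_bigr => j _.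
by rewrite rowK scaler_sumr; apply: eq_bigr => i _; rewrite scalerA mulrC.
Qed.

(** The coordinates of an image form a column of [M], whereas here they multiply [B] from the left;
    hence the transpose. *)
Lemma mx_wrtE B (T : 'M[C]_7) M :
  mx_wrt B (mulmxr T) M <-> B *m T = M^T *m B.
Proof.
have E k : row k (M^T *m B) = \sum_(l < 6) M l k *: row l B.
  by rewrite row_mul mulmx_sum_row; apply: eq_bigr => l _; rewrite !mxE.
split=> [e | e k]; last by rewrite /= -row_mul e E.
by apply/row_matrixP=> k; rewrite row_mul E -e.
Qed.

Lemma mx_wrt_ad B x M : mx_wrt B (bracket c x) M <-> B *m ad_mx x = M^T *m B.
Proof.
rewrite -mx_wrtE; split=> e k; first by rewrite /= -bracketE e.
by rewrite bracketE; apply: e.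
Qed.

Variable U : 'M[C]_(6, 7).
Hypotheses (lie : is_real_lie_algebra c) (abU : is_abelian_ideal6 c U).

Lemma ideal_free : row_free U.
Proof. by case: abU => _ rU _ _; apply/eqP. Qed.

Lemma ideal_real : realmx U.
Proof. by case: abU. Qed.

Lemma span_row k : in_span U (row k U).
Proof.
exists (delta_mx 0 k); rewrite rowE; split=> // i j.
by rewrite mxE; case: (_ && _); rewrite ?real0 ?real1.
Qed.

Lemma ad_ideal f : realmx f ->
  exists2 D : 'M[C]_6, realmx D & U *m ad_mx f = D *m U.
Proof.
move=> rf; case: abU => rU _ ideal _.
have sub : (U *m ad_mx f <= U)%MS.
  apply/row_subP=> k; rewrite row_mul -bracketE.
  by have [a [_ ->]] := ideal _ _ rf (span_row k); apply: submxMl.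
have [D e] := submxP sub; exists D => //.
apply: (realmx_free ideal_free rU); rewrite -e => i j.
have [a [ra ea]] := ideal _ _ rf (span_row i).
have := realmx_mul ra rU 0 j; rewrite -ea bracketE.
by rewrite -row_mul mxE.
Qed.

(** Passing to row vectors transposes the two blocks, which preserves [sl3]; the adapted basis
    becomes a base change [P] relative to [U]. *)
Lemma cond_iiE :
  cond_ii c U <-> forall f D, realmx f -> ~ in_span U f -> U *m ad_mx f = D *m U ->
  exists A B P, [/\ sl3 A, sl3 B, realmx P, P \in unitmx
    & P *m D = (block_mx A 0 0 B : 'M[C]_(3 + 3)) *m P].
Proof.
have trE A B : (block_mx A 0 0 B : 'M[C]_(3 + 3))^T = block_mx A^T 0 0 B^T.
  by rewrite tr_block_mx !trmx0.
have sltr A : sl3 A -> sl3 (A^T : 'M[C]_3).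
  by move=> [rA tA]; split; [apply: realmx_tr | rewrite mxtrace_tr].
split=> [ii f D rf nf De | H f rf nf].
  have [A [B [_ [sA sB [P [rP uP ->]] /mx_wrt_ad]]]] := ii f rf nf.
  rewrite trE -mulmxA De !mulmxA => /(row_free_inj ideal_free) e.
  by exists A^T, B^T, P; split=> //; apply: sltr.
have [D rD De] := ad_ideal rf.
have [A [B [P [sA sB rP uP e]]]] := H f D rf nf De.
exists A^T, B^T, (P *m U); split; [exact: sltr | exact: sltr | by exists P | ].
by apply/mx_wrt_ad; rewrite trE !trmxK -mulmxA De mulmxA e mulmxA.
Qed.

Lemma cond_ii_iii : cond_ii c U <-> cond_iii c U.
Proof.
rewrite cond_iiE; split=> [ii f rf nf M /mx_wrt_ad Me | iii f D rf nf De].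
  have [A [B [P [[rA tA] [rB tB] rP uP e]]]] := ii f _ rf nf Me.
  have sM : similar M (block_mx A^T 0 0 B^T : 'M_(3 + 3)).
    rewrite -[M]trmxK -(trmxK (block_mx _ _ _ _ : 'M_(3 + 3))); apply: similar_tr.
    by exists P; rewrite tr_block_mx !trmx0 !trmxK.
  have [J1 [jJ1 sJ1]] := jordan_exists3 A^T.
  have [J2 [jJ2 sJ2]] := jordan_exists3 B^T.
  exists J1, J2; split; first by rewrite -(similar_mxtrace sJ1) mxtrace_tr.
  - by rewrite -(similar_mxtrace sJ2) mxtrace_tr.
  - by exists A^T; split=> //; apply: realmx_tr.
  - by exists B^T; split=> //; apply: realmx_tr.
  split; first exact: jordan_block.
  by exact: similar_trans sM (similar_block sJ1 sJ2).
have [J1 [J2 [t1 t2 [A [rA [_ sA]]] [B [rB [_ sB]]] [_ sM]]]] :=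
  iii f rf nf D^T (proj2 (mx_wrt_ad _ _ _) (etrans De (f_equal (mulmx^~ U) (esym (trmxK D))))).
have rD : realmx D.
  have [D' rD' e] := ad_ideal rf.
  by have := row_free_inj ideal_free (etrans (esym De) e) => ->.
have [P [rP uP e]] : exists P : 'M[C]_6, [/\ realmx P, P \in unitmx
    & P *m D = (block_mx A^T 0 0 B^T : 'M[C]_(3 + 3)) *m P].
  apply: similar_real => //.
    apply/realmxP; rewrite (map_block_mx _ A^T) !map_mx0.
    by rewrite (proj1 (realmxP _) (realmx_tr rA)) (proj1 (realmxP _) (realmx_tr rB)).
  have -> : block_mx A^T 0 0 B^T = (block_mx A 0 0 B : 'M_(3 + 3))^T.
    by rewrite tr_block_mx !trmx0.
  rewrite -[D]trmxK; apply: similar_tr.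
  exact: similar_trans sM (similar_block (similar_sym sA) (similar_sym sB)).
exists A^T, B^T, P; split=> //; split; rewrite ?mxtrace_tr; try exact: realmx_tr.
  by rewrite (similar_mxtrace sA).
by rewrite (similar_mxtrace sB).
Qed.

End Action.

(** * The model three-form *)

Lemma e3E (C : numClosedFieldType) i j k (a b d : 'rV[C]_7) :
  e3 i j k a b d =
  a 0 (ix i) * b 0 (ix j) * d 0 (ix k) + a 0 (ix j) * b 0 (ix k) * d 0 (ix i)
  + a 0 (ix k) * b 0 (ix i) * d 0 (ix j) - a 0 (ix k) * b 0 (ix j) * d 0 (ix i)
  - a 0 (ix j) * b 0 (ix i) * d 0 (ix k) - a 0 (ix i) * b 0 (ix k) * d 0 (ix j).
Proof.
rewrite -mx3_det; congr (\det _).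
by apply/matrixP=> -[[|[|[|//]]] ?] [[|[|[|//]]] ?]; rewrite !mxE.
Qed.

Lemma big_ix (C : nmodType) (F : 'I_7 -> C) :
  \sum_(i < 7) F i
  = F (ix 1) + F (ix 2) + F (ix 3) + F (ix 4) + F (ix 5) + F (ix 6) + F (ix 7).
Proof.
rewrite !big_ord_recl big_ord0 addr0 !addrA.
by do 6?congr (_ + _); congr F; apply: val_inj; rewrite /ix /= inordK.
Qed.

Lemma ix_ind (P : nat -> Prop) :
  P 1 -> P 2 -> P 3 -> P 4 -> P 5 -> P 6 -> P 7 -> forall k, (0 < k < 8)%N -> P k.
Proof.
move=> P1 P2 P3 P4 P5 P6 P7 k /andP[].
by do 8?[case: k => [|k] //].
Qed.

Lemma ixK k : (0 < k < 8)%N -> ix k = k.-1 :> nat.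
Proof. by case: k => // k; rewrite /ix /= => ?; rewrite inordK. Qed.

Section Form.
Variable C : numClosedFieldType.
Implicit Types x y z : 'rV[C]_7.

Lemma phi1_linear k x x' y z :
  phi1 (k *: x + x') y z = k * phi1 x y z + phi1 x' y z.
Proof. by rewrite /phi1 !e3E !mxE; ring. Qed.

Lemma phi1_skew12 x y z : phi1 y x z = - phi1 x y z.
Proof. by rewrite /phi1 !e3E; ring. Qed.

Lemma phi1_skew23 x y z : phi1 x z y = - phi1 x y z.
Proof. by rewrite /phi1 !e3E; ring. Qed.

Lemma phi1_xx x z : phi1 x x z = 0.
Proof. by rewrite /phi1 !e3E; ring. Qed.

Lemma eta7E x y : eta7 x y =
  - (x 0 (ix 1) * y 0 (ix 1)) - x 0 (ix 2) * y 0 (ix 2) - x 0 (ix 3) * y 0 (ix 3)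
  - x 0 (ix 4) * y 0 (ix 4) + x 0 (ix 5) * y 0 (ix 5) + x 0 (ix 6) * y 0 (ix 6)
  + x 0 (ix 7) * y 0 (ix 7).
Proof. by rewrite /eta7 big_ix !ixK //=; ring. Qed.


Definition minor (n x : 'rV[C]_7) (i j : nat) : C :=
  n 0 (ix i) * x 0 (ix j) - n 0 (ix j) * x 0 (ix i).

(* The coefficients make [eta7 (cross n x)] the contraction of [phi1] with [n] and [x]. *)
Definition cross n x : 'rV[C]_7 :=
  let p := minor n x in
  \row_(i < 7) nth 0
    [:: p 2 7 - p 3 5 + p 4 6; p 7 1 + p 3 6 + p 4 5;
        p 4 7 - p 5 1 + p 6 2; p 7 3 + p 6 1 + p 5 2;
        p 6 7 + p 1 3 - p 2 4; p 7 5 - p 1 4 - p 2 3;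
        p 5 6 - p 1 2 - p 3 4] i.

(** The equations are bundled in one product type so that a single [rewrite] can use any of them. *)
Lemma crossE n x : let p := minor n x in let X k := cross n x 0 (ix k) in
  (((X 1 = p 2 7 - p 3 5 + p 4 6)%R * (X 2 = p 7 1 + p 3 6 + p 4 5)%R
  * (X 3 = p 4 7 - p 5 1 + p 6 2)%R * (X 4 = p 7 3 + p 6 1 + p 5 2)%R
  * (X 5 = p 6 7 + p 1 3 - p 2 4)%R * (X 6 = p 7 5 - p 1 4 - p 2 3)%R
  * (X 7 = p 5 6 - p 1 2 - p 3 4)%R))%type.
Proof. by rewrite /= /cross; do 6?[split]; rewrite mxE ixK. Qed.

Lemma eta_cross n x y : eta7 (cross n x) y = phi1 n x y.
Proof. by rewrite eta7E !crossE /minor /phi1 !e3E; ring. Qed.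

Lemma eta7C x y : eta7 x y = eta7 y x.
Proof. by rewrite !eta7E; ring. Qed.

(** For arguments orthogonal to [n] the right-hand side vanishes, so the cross product with [n] may
    be moved from one slot of [phi1] to the next. *)
Lemma phi1_cross n x y z :
  phi1 (cross n x) y z - phi1 x (cross n y) z
  = eta7 n y * eta7 x z + eta7 n x * eta7 y z - 2%:R * (eta7 n z * eta7 x y).
Proof.
rewrite !eta7E /phi1 !e3E !crossE /minor.
by ring.
Qed.

Lemma rV7P (x y : 'rV[C]_7) : (forall k, (0 < k < 8)%N -> x 0 (ix k) = y 0 (ix k)) -> x = y.
Proof.
move=> e; apply/rowP=> i.
have -> : i = ix i.+1 by apply: val_inj; rewrite /= ixK //; exact: (ltn_ord i).
exact/e/(ltn_ord i).
Qed.

(** If [eta7 n n = -1], this makes the cross product with [n] an involution on the orthogonal of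
    [n]. *)
Lemma cross_cross n x : cross n (cross n x) = eta7 n x *: n - eta7 n n *: x.
Proof.
apply: rV7P; apply: ix_ind;
  rewrite !crossE /minor !crossE /minor !mxE !eta7E; ring.
Qed.

Lemma eta7_delta x k : (0 < k < 8)%N ->
  eta7 x (delta_mx 0 (ix k)) = (if (k < 5)%N then -1 else 1) * x 0 (ix k).
Proof.
move=> k8; rewrite /eta7 (bigD1 (ix k)) //= big1 => [|i /negPf ik]; last first.
  by rewrite !mxE ik andbF mulr0.
by rewrite !mxE !eqxx mulr1 addr0 ixK //; case: k k8.
Qed.

(** Any two indices occur together in exactly one monomial of [phi1], so every component of the
    contraction is a single coordinate of [x] up to sign. *)
Lemma phi1_basis x : let X i j := phi1 x (delta_mx 0 (ix i)) (delta_mx 0 (ix j)) in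
  ((X 1 2 = - x 0 (ix 7))%R * (X 1 3 = x 0 (ix 5))%R * (X 1 4 = - x 0 (ix 6))%R
  * (X 1 5 = - x 0 (ix 3))%R * (X 1 6 = x 0 (ix 4))%R * (X 1 7 = x 0 (ix 2))%R
  * (X 2 3 = - x 0 (ix 6))%R * (X 2 4 = - x 0 (ix 5))%R * (X 2 5 = x 0 (ix 4))%R
  * (X 2 6 = x 0 (ix 3))%R * (X 2 7 = - x 0 (ix 1))%R * (X 3 4 = - x 0 (ix 7))%R
  * (X 3 5 = x 0 (ix 1))%R * (X 3 6 = - x 0 (ix 2))%R * (X 3 7 = x 0 (ix 4))%R
  * (X 4 5 = - x 0 (ix 2))%R * (X 4 6 = - x 0 (ix 1))%R * (X 4 7 = - x 0 (ix 3))%R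
  * (X 5 6 = x 0 (ix 7))%R * (X 5 7 = - x 0 (ix 6))%R * (X 6 7 = x 0 (ix 5))%R)%type.
Proof.
by rewrite /=; do 20?[split]; rewrite -eta_cross eta7_delta //= crossE /minor !mxE
  -!val_eqE /= !ixK //=; ring.
Qed.

(* The seven hypotheses run over the lines of the Fano plane formed by the indices of [phi1]. *)
Lemma fano_sum0 (s : nat -> C) :
  s 1 + s 2 + s 7 = 0 -> s 3 + s 4 + s 7 = 0 -> s 5 + s 6 + s 7 = 0 ->
  s 1 + s 3 + s 5 = 0 -> s 1 + s 4 + s 6 = 0 -> s 2 + s 3 + s 6 = 0 ->
  s 2 + s 4 + s 5 = 0 -> forall k, (0 < k < 8)%N -> s k = 0.
Proof.
move=> l1 l2 l3 l4 l5 l6 l7.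
have n6 : 6%:R != 0 :> C by rewrite pnatr_eq0.
pose S := (s 1 + s 2 + s 7) + (s 3 + s 4 + s 7) + (s 5 + s 6 + s 7) + (s 1 + s 3 + s 5)
  + (s 1 + s 4 + s 6) + (s 2 + s 3 + s 6) + (s 2 + s 4 + s 5).
have S0 : S = 0 by rewrite /S l1 l2 l3 l4 l5 l6 l7 !addr0.
(* Each index lies on three lines, and each other index on exactly one of these; three times their
   sum minus the sum [S] over all lines is [6 * s k]. *)
have E u v w : u = 0 -> v = 0 -> w = 0 -> 3%:R * (u + v + w) - S = 0 :> C.
  by move=> -> -> ->; rewrite S0 !addr0 mulr0 subr0.
apply: ix_ind; apply: (mulfI n6); rewrite mulr0.
- by rewrite -(E _ _ _ l1 l4 l5) /S; ring.
- by rewrite -(E _ _ _ l1 l6 l7) /S; ring.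
- by rewrite -(E _ _ _ l2 l4 l6) /S; ring.
- by rewrite -(E _ _ _ l2 l5 l7) /S; ring.
- by rewrite -(E _ _ _ l3 l4 l7) /S; ring.
- by rewrite -(E _ _ _ l3 l5 l6) /S; ring.
- by rewrite -(E _ _ _ l1 l2 l3) /S; ring.
Qed.

(* The Pfaffians of a decomposable two-form vanish; those of the contraction of
   [phi1] with [x] are signed sums of the squares of three coordinates of [x]. *)
Lemma phi1_contraction_indecomposable x (al be : 'rV[C]_7 -> C) :
  (forall y z, phi1 x y z = al y * be z - al z * be y) -> x = 0.
Proof.
move=> dec.
pose p i j := al (delta_mx 0 (ix i)) * be (delta_mx 0 (ix j))
  - al (delta_mx 0 (ix j)) * be (delta_mx 0 (ix i)).
have pE i j : p i j = phi1 x (delta_mx 0 (ix i)) (delta_mx 0 (ix j)) by rewrite dec.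
have plucker i j k l : p i j * p k l - p i k * p j l + p i l * p j k = 0.
  by rewrite /p; ring.
pose s k := (if (k < 5)%N then -1 else 1) * x 0 (ix k) ^+ 2.
have s0 : forall k, (0 < k < 8)%N -> s k = 0.
  (* The relation for a line is the Pluecker relation on the four indices off that line. *)
  apply: fano_sum0.
  - by rewrite -[RHS]oppr0 -(plucker 3 4 5 6)%N !pE !phi1_basis /s /=; ring.
  - by rewrite -[RHS]oppr0 -(plucker 1 2 5 6)%N !pE !phi1_basis /s /=; ring.
  - by rewrite -(plucker 1 2 3 4)%N !pE !phi1_basis /s /=; ring.
  - by rewrite -[RHS]oppr0 -(plucker 2 4 6 7)%N !pE !phi1_basis /s /=; ring.
  - by rewrite -(plucker 2 3 5 7)%N !pE !phi1_basis /s /=; ring.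
  - by rewrite -(plucker 1 4 5 7)%N !pE !phi1_basis /s /=; ring.
  - by rewrite -(plucker 1 3 6 7)%N !pE !phi1_basis /s /=; ring.
apply: rV7P => k k8; rewrite mxE; apply/eqP; rewrite -sqrf_eq0.
have /eqP := s0 k k8; rewrite /s mulf_eq0 => /orP[|//].
by case: ifP; rewrite ?oppr_eq0 oner_eq0.
Qed.

End Form.

(** * Stabilizer of the restricted three-form *)

Section Stabilizer.
Variable C : numClosedFieldType.
Implicit Types x y z n : 'rV[C]_7.

Lemma phi1Dl x x' y z : phi1 (x + x') y z = phi1 x y z + phi1 x' y z.
Proof. by rewrite -{1}[x]scale1r phi1_linear mul1r. Qed.

Lemma phi1_0l y z : phi1 (0 : 'rV[C]_7) y z = 0.
Proof. by apply: (addrI (phi1 0 y z)); rewrite -phi1Dl !addr0. Qed.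

Lemma phi1Zl k x y z : phi1 (k *: x) y z = k * phi1 x y z.
Proof. by rewrite -[k *: x]addr0 phi1_linear phi1_0l addr0. Qed.

Lemma phi1Dm x y y' z : phi1 x (y + y') z = phi1 x y z + phi1 x y' z.
Proof. by rewrite !(phi1_skew12 _ x) phi1Dl opprD. Qed.

Lemma phi1Zm k x y z : phi1 x (k *: y) z = k * phi1 x y z.
Proof. by rewrite !(phi1_skew12 _ x) phi1Zl mulrN. Qed.

Lemma phi1Dr x y z z' : phi1 x y (z + z') = phi1 x y z + phi1 x y z'.
Proof. by rewrite !(phi1_skew23 x _ y) phi1Dm opprD. Qed.

Lemma phi1Zr k x y z : phi1 x y (k *: z) = k * phi1 x y z.
Proof. by rewrite !(phi1_skew23 x _ y) phi1Zm mulrN. Qed.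

Lemma phi1_xyx x y : phi1 x y x = 0.
Proof. by rewrite phi1_skew23 phi1_xx oppr0. Qed.

Lemma phi1_xyy x y : phi1 x y y = 0.
Proof. by rewrite phi1_skew12 phi1_xyx oppr0. Qed.

Definition phi1E := (phi1Dl, phi1Dm, phi1Dr, phi1Zl, phi1Zm, phi1Zr).

Lemma eta7Z k x y : eta7 x (k *: y) = k * eta7 x y.
Proof. by rewrite !eta7E !mxE; ring. Qed.

Lemma mul_rV3 (u : 'rV[C]_3) m (Y : 'M_(3, m)) :
  u *m Y = u 0 0 *: row 0 Y + u 0 1 *: row 1 Y + u 0 2%:R *: row 2%:R Y.
Proof.
rewrite mulmx_sum_row !big_ord_recl big_ord0 addr0 addrA.
by do 2?[congr (_ + _)]; congr (u 0 _ *: row _ Y); apply: val_inj.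
Qed.

(** An alternating trilinear form on a three-dimensional space is a multiple of the determinant. *)
Lemma phi1_row3 (Y : 'M[C]_(3, 7)) (u v w : 'rV_3) :
  phi1 (u *m Y) (v *m Y) (w *m Y)
  = phi1 (row 0 Y) (row 1 Y) (row 2%:R Y)
    * (u 0 0 * (v 0 1 * w 0 2%:R - v 0 2%:R * w 0 1)
       - u 0 1 * (v 0 0 * w 0 2%:R - v 0 2%:R * w 0 0)
       + u 0 2%:R * (v 0 0 * w 0 1 - v 0 1 * w 0 0)).
Proof.
rewrite !mul_rV3; set a := row 0 Y; set b := row 1 Y; set d := row 2%:R Y.
rewrite !phi1E !(phi1_xx, phi1_xyx, phi1_xyy).
rewrite (phi1_skew12 a b) (phi1_skew23 a b d) (phi1_skew12 a d b) (phi1_skew23 b a d).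
rewrite (phi1_skew12 b d a) (phi1_skew23 b a d) (phi1_skew12 a b) (phi1_skew23 a b d).
by ring.
Qed.

(** An endomorphism acts on a volume form, as a derivation, by its trace. *)
Lemma phi1_row3_trace (Y : 'M[C]_(3, 7)) (A : 'M_3) :
  (forall u v w, phi1 (u *m A *m Y) (v *m Y) (w *m Y)
     + phi1 (u *m Y) (v *m A *m Y) (w *m Y) + phi1 (u *m Y) (v *m Y) (w *m A *m Y) = 0) <->
  phi1 (row 0 Y) (row 1 Y) (row 2%:R Y) * \tr A = 0.
Proof.
set t := phi1 _ _ _.
pose det3 (u v w : 'rV[C]_3) := u 0 0 * (v 0 1 * w 0 2%:R - v 0 2%:R * w 0 1)
       - u 0 1 * (v 0 0 * w 0 2%:R - v 0 2%:R * w 0 0)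
       + u 0 2%:R * (v 0 0 * w 0 1 - v 0 1 * w 0 0).
have E u v w : phi1 (u *m A *m Y) (v *m Y) (w *m Y)
     + phi1 (u *m Y) (v *m A *m Y) (w *m Y) + phi1 (u *m Y) (v *m Y) (w *m A *m Y)
     = t * \tr A * det3 u v w.
  rewrite !phi1_row3 -/t /det3.
  have trA : \tr A = A 0 0 + A 1 1 + A 2%:R 2%:R.
    rewrite /mxtrace !big_ord_recl big_ord0 addr0 addrA.
    by do 2?[congr (_ + _)]; congr (A _ _); apply: val_inj.
  have mA (u' : 'rV[C]_3) k : (u' *m A) 0 k
      = u' 0 0 * A 0 k + u' 0 1 * A 1 k + u' 0 2%:R * A 2%:R k.
    by rewrite mul_rV3 !mxE.
  by rewrite trA !mA; ring.
split=> [H | H u v w]; last by rewrite E H mul0r.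
have := H (delta_mx 0 0) (delta_mx 0 1) (delta_mx 0 2%:R).
rewrite E /det3 !mxE /= !(mulr0, mul0r, mulr1, subr0, addr0) => //.
Qed.

(** All components of the contraction of [phi1] with [u *m Y] vanish except those involving [n]. The
    contraction is then the wedge of two linear forms, hence decomposable, and the vector is
    zero. *)
Lemma phi1_block_nondegenerate n (Y Z : 'M[C]_(3, 7)) :
  (forall y, exists a b, y = a *m Y + b *m Z - eta7 y n *: n) ->
  (forall a b w, eta7 n w = 0 -> phi1 (a *m Y) (b *m Z) w = 0) ->
  (forall a, eta7 n (a *m Y) = 0) -> (forall a, eta7 n (a *m Z) = 0) ->
  forall u, (forall a b, phi1 (u *m Y) (a *m Y) (b *m Y) = 0) -> u *m Y = 0.
Proof.
move=> dec mix nY nZ u H.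
apply: (phi1_contraction_indecomposable (al := fun y => - eta7 y n)
  (be := phi1 (u *m Y) n)) => y z.
have [a [b ey]] := dec y; have [a' [b' ez]] := dec z.
have {}ey : y = a *m Y + b *m Z + (- eta7 y n) *: n by rewrite scaleNr.
have {}ez : z = a' *m Y + b' *m Z + (- eta7 z n) *: n by rewrite scaleNr.
move: (- eta7 y n) ey (- eta7 z n) ez => s -> t ->.
have mixY d e f : phi1 (d *m Y) (e *m Z) (f *m Y) = 0 by rewrite mix.
have mixZ d e f : phi1 (d *m Y) (e *m Z) (f *m Z) = 0 by rewrite mix.
rewrite !phi1E !H !(mixY, mixZ, phi1_xyy).
rewrite (phi1_skew23 _ (b' *m Z)) mixY.
by rewrite !(phi1_skew23 _ n); ring.
Qed.

End Stabilizer.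

(** * Gram matrices and the unit normal of the ideal *)

Section Normal.
Variable C : numClosedFieldType.

(** The Gram matrix with [k] negative signs: [sgn_mx 7 4] is the metric of the model, [sgn_mx 6 3]
    that of the ideal. *)
Definition sgn_mx n k : 'M[C]_n := diag_mx (\row_(i < n) (if (i < k)%N then -1 else 1)).

Lemma realmx_sgn n k : realmx (sgn_mx n k).
Proof.
move=> i j; rewrite !mxE; case: (i == j); case: ifP => _;
  by rewrite ?mulr1n ?mulr0n ?rpredN ?real0 ?real1.
Qed.

Lemma sgn_mxK n k : sgn_mx n k *m sgn_mx n k = 1%:M.
Proof.
apply/matrixP=> i j; rewrite mul_diag_mx !mxE.
by case: ifP; case: (i == j); rewrite ?mulr0 // ?mulN1r ?opprK ?mul1r.
Qed.

Lemma sgn_mx_tr n k : (sgn_mx n k)^T = sgn_mx n k.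
Proof. exact: tr_diag_mx. Qed.

Lemma eta7_mx (x y : 'rV[C]_7) : eta7 x y = (x *m sgn_mx 7 4 *m y^T) 0 0.
Proof.
rewrite /eta7 mxE; apply: eq_bigr => i _.
by rewrite mul_mx_diag !mxE mulrC (mulrC (x 0 i)) mulrC.
Qed.

Lemma gram_entry m n (A : 'M[C]_(m, 7)) (B : 'M_(n, 7)) i j :
  (A *m sgn_mx 7 4 *m B^T) i j = eta7 (row i A) (row j B).
Proof.
rewrite eta7_mx tr_row -row_mul mxE [RHS]mxE; apply: eq_bigr => k _.
by rewrite [row _ _ _ _]mxE [col _ _ _ _]mxE.
Qed.

Lemma gram_col m1 m2 p (A : 'M[C]_(m1, p)) (B : 'M_(m2, p)) E :
  col_mx A B *m E *m (col_mx A B)^T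
  = block_mx (A *m E *m A^T) (A *m E *m B^T) (B *m E *m A^T) (B *m E *m B^T).
Proof. by rewrite tr_col_mx mul_col_mx mul_col_row. Qed.

Lemma gram_dual m1 m2 p q (A : 'M[C]_(m1, p)) (B : 'M_(m2, p)) (E : 'M_(q, p)) S T :
  E *m (col_mx A B)^T *m block_mx S 0 0 T *m col_mx A B
  = E *m A^T *m S *m A + E *m B^T *m T *m B.
Proof.
rewrite tr_col_mx mul_mx_row mul_row_block !mulmx0 addr0 add0r.
by rewrite mul_row_col.
Qed.

Lemma normal_exists (W : 'M[C]_(6, 7)) :
  realmx W -> W *m sgn_mx 7 4 *m W^T = sgn_mx 6 3 ->
  exists n : 'rV[C]_7, [/\ realmx n, eta7 n n = -1,
    (forall x : 'rV_6, eta7 n (x *m W) = 0)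
    & forall y, y = y *m sgn_mx 7 4 *m W^T *m sgn_mx 6 3 *m W - eta7 y n *: n].
Proof.
set E := sgn_mx 7 4; set S := sgn_mx 6 3 => rW gW.
have rE : realmx E := @realmx_sgn 7 4.
have [n0 [rn0 n0E nz0]] : exists n0 : 'rV[C]_7,
    [/\ realmx n0, n0 *m (E *m W^T) = 0 & n0 != 0].
  (* The kernel matrix is real, so any nonzero row of it is a real normal. *)
  have rK : realmx (kermx (E *m W^T)).
    apply/realmxP; rewrite map_kermx; congr kermx; apply/realmxP.
    by apply: realmx_mul => //; apply: realmx_tr.
  have /rowV0Pn[v] : kermx (E *m W^T) != 0.
    rewrite -mxrank_eq0 mxrank_ker subn_eq0 -ltnNge.
    by rewrite (leq_ltn_trans (rank_leq_col _)).
  have [i nz|z] := pickP (fun i => row i (kermx (E *m W^T)) != 0).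
    move=> _ _; exists (row i (kermx (E *m W^T))); split=> //.
      by move=> k l; rewrite mxE; apply: rK.
    by rewrite -row_mul mulmx_ker row0.
  suff -> : kermx (E *m W^T) = 0 by rewrite submx0 => ->.
  by apply/row_matrixP=> i; rewrite row0; apply/eqP/negbFE/z.
have Wn0 : W *m E *m n0^T = 0.
  by apply: trmx_inj; rewrite !trmx_mul trmxK sgn_mx_tr trmx0.
pose G : 'M[C]_7 := (col_mx W n0 : 'M_(6 + 1, 7)).
pose q := eta7 n0 n0.
have gG : G *m E *m G^T = (block_mx S 0 0 q%:M : 'M_(6 + 1)).
  rewrite /G (gram_col W n0 E) gW Wn0 -(mulmxA n0 E) n0E.
  by have -> : n0 *m E *m n0^T = q%:M by rewrite [LHS]mx11_scalar -eta7_mx.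
have detE : \det E = 1.
  by rewrite det_diag !big_ord_recl big_ord0 !mxE /=; ring.
have detS : \det S = -1.
  by rewrite det_diag !big_ord_recl big_ord0 !mxE /=; ring.
(* The norm of [n0] is minus the square of the real number [\det G], so dividing by that determinant
   normalises [n0] without a square root. *)
have q_det : q = - \det G ^+ 2.
  have /(f_equal determinant) := gG.
  rewrite !det_mulmx det_tr detE (det_ublock (n1 := 6) (n2 := 1)) detS det_scalar1 mulN1r => e.
  by rewrite -[LHS]opprK -e; ring.
have nzG : \det G != 0.
  apply/negP=> /det0P[v nzv vG].
  pose a : 'rV[C]_6 := lsubmx (v : 'rV_(6 + 1)).
  pose t : 'rV[C]_1 := rsubmx (v : 'rV_(6 + 1)).
  have e : a *m W + t *m n0 = 0.
    by rewrite -vG -(mul_row_col a t W n0) hsubmxK.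
  have a0 : a = 0.
    have := f_equal (mulmx^~ (E *m W^T)) e.
    rewrite mulmxDl -!mulmxA n0E mulmx0 addr0 mul0mx (mulmxA W) gW.
    by move/(f_equal (mulmx^~ S)); rewrite -mulmxA sgn_mxK mulmx1 mul0mx.
  move: e; rewrite a0 mul0mx add0r [t]mx11_scalar mul_scalar_mx => /eqP.
  rewrite scaler_eq0 (negPf nz0) orbF => /eqP t0.
  move: nzv; rewrite -[v](hsubmxK (v : 'rV_(6 + 1))) -/a -/t a0 [t]mx11_scalar t0.
  by rewrite raddf0 row_mx0 eqxx.
pose n := (\det G)^-1 *: n0.
have rG : realmx G by exact: (realmx_col (m := 6) (n := 1)).
have rdet : (\det G)^-1 \is Num.real.
  by rewrite rpredV; apply/CrealP; rewrite -det_map_mx (proj1 (realmxP _) rG).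
have nn : eta7 n n = -1.
  by rewrite eta7Z eta7C eta7Z -/q q_det; field.
have nW x : eta7 n (x *m W) = 0.
  rewrite eta7C eta7Z eta7_mx -!mulmxA (mulmxA W) Wn0 mulmx0 mxE mulr0 //.
have Wn : W *m E *m n^T = 0.
  by rewrite linearZ /= -scalemxAr Wn0 scaler0.
have nWE : n *m E *m W^T = 0.
  by rewrite -!scalemxAl -mulmxA n0E scaler0.
exists n; split=> //; first by move=> i j; rewrite mxE rpredM.
pose N : 'M[C]_7 := (col_mx W n : 'M_(6 + 1, 7)).
pose T : 'M[C]_7 := (block_mx S 0 0 (-1)%:M : 'M_(6 + 1)).
have gN : N *m E *m N^T = T.
  rewrite /N (gram_col W n E) gW Wn nWE.
  by have -> : n *m E *m n^T = (-1)%:M by rewrite [LHS]mx11_scalar -eta7_mx nn.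
have TT : block_mx S 0 0 (-1)%:M *m block_mx S 0 0 (-1)%:M = 1%:M :> 'M_(6 + 1).
  rewrite mulmx_block !mulmx0 !mul0mx !addr0 !add0r sgn_mxK -scalar_mxM mulrNN mulr1.
  by rewrite -scalar_mx_block.
(* A right inverse of the square matrix [N] is also a left inverse; this expands [y] in the
   pseudo-orthonormal basis [N]. *)
have : E *m N^T *m T *m N = 1%:M by apply: mulmx1C; rewrite !mulmxA gN; apply: TT.
rewrite /N /T (gram_dual W n E S) => e y.
rewrite -[LHS]mulmx1 -e mulmxDr !mulmxA; congr (_ + _).
rewrite mul_mx_scalar scaleN1r mulNmx; congr (- _).
by rewrite [y *m E *m _]mx11_scalar mul_scalar_mx -eta7_mx.
Qed.

End Normal.
Arguments sgn_mx {C} n k.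

(** * The eigenspaces of the involution and the block form *)

Section Core.
Variable C : numClosedFieldType.

Lemma cross_linear (n : 'rV[C]_7) k x y : cross n (k *: x + y) = k *: cross n x + cross n y.
Proof.
by apply: rV7P; apply: ix_ind; rewrite [RHS]mxE [X in _ = X + _]mxE !crossE /minor !mxE; ring.
Qed.

Lemma cross_mx (n : 'rV[C]_7) : realmx n ->
  exists2 J : 'M[C]_7, realmx J & forall x, x *m J = cross n x.
Proof.
move=> rn; exists (\matrix_i cross n (delta_mx 0 i)) => [i j | x].
  have rd k l : (delta_mx 0 k : 'rV[C]_7) 0 l \is Num.real.
    by rewrite mxE; case: (_ && _); rewrite ?real0 ?real1.
  rewrite mxE (_ : j = ix j.+1); last by apply: val_inj; rewrite /= ixK //; apply: (ltn_ord j).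
  move: j.+1 (ltn_ord j : (0 < j.+1 < 8)%N); apply: ix_ind; rewrite crossE /minor;
    by do ?[exact: rn | exact: rd | apply: rpredM | apply: rpredB | apply: rpredD].
rewrite mulmx_sum_row [in RHS](row_sum_delta x).
have c0 : cross n 0 = 0.
  by apply: (addrI (cross n 0)); rewrite -[X in X + _]scale1r -cross_linear scale1r !addr0.
rewrite (big_morph (cross n) (id1 := 0) (op1 := +%R)) //; last first.
  by move=> u v; rewrite -[u in LHS]scale1r cross_linear scale1r.
apply: eq_bigr => i _; rewrite rowK.
by rewrite -[in RHS](addr0 (_ *: _)) cross_linear c0 addr0.
Qed.

(** The eigenspaces are the row spaces of [1 + K] and [1 - K]. Their ranks add up to [n + n], since
    the product of the two matrices is zero and their sum is twice the identity. The ranks agree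
    because [S] carries [1 + K] to the transpose of [1 - K]. *)
Lemma involution_eigenspaces n (K S : 'M[C]_(n + n)) :
  realmx K -> K *m K = 1%:M -> S \in unitmx -> K *m S = - (S *m K^T) ->
  exists E1 E2 : 'M[C]_(n, n + n), [/\ realmx E1, realmx E2, E1 *m K = E1,
    E2 *m K = - E2 & col_mx E1 E2 \in unitmx].
Proof.
move=> rK KK uS skew.
pose Kp := 1%:M + K; pose Km := 1%:M - K.
have rp : realmx Kp.
  by apply/realmxP; rewrite map_mxD map_mx1 (proj1 (realmxP _) rK).
have rm : realmx Km.
  by apply/realmxP; rewrite map_mxB map_mx1 (proj1 (realmxP _) rK).
have eqr : \rank Kp = \rank Km.
  rewrite -(mxrankMfree Kp (_ : row_free S)) ?row_free_unit //.
  rewrite /Kp mulmxDl mul1mx skew -{1}[S]mulmx1 -mulmxBr -trmx1 -linearB /=.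
  by rewrite -mxrank_tr trmx_mul trmxK mxrankMfree // row_free_unit unitmx_tr.
have le : (\rank Kp + \rank Km <= n + n)%N.
  apply: mulmx0_rank_max; rewrite /Kp /Km mulmxBr mulmx1 mulmxDl mul1mx KK.
  by rewrite [K + _]addrC subrr.
have full : (1%:M <= Kp + Km)%MS.
  have -> : 1%:M = 2%:R^-1 *: (Kp + Km).
    by rewrite /Kp /Km addrACA subrr addr0 -mulr2n -scaler_nat scalerA mulVf ?scale1r ?pnatr_eq0.
  by apply: scalemx_sub; apply: addmx_sub_adds; rewrite ?submx_refl.
have ge : (n + n <= \rank Kp + \rank Km)%N.
  by rewrite -{1}(mxrank1 C (n + n)) (leq_trans (mxrankS full)) // mxrank_adds_leqif.
have rk : \rank Kp = n.
  have half m k : (m + m = k + k)%N -> m = k.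
    by rewrite !addnn => /double_inj.
  by apply: half; apply/eqP; rewrite {2}eqr eqn_leq le ge.
have [E1 r1 e1] := real_row_base rp rk.
have [E2 r2 e2] := real_row_base rm (etrans (esym eqr) rk).
exists E1, E2; split=> //.
- have /submxP[X ->] : (E1 <= Kp)%MS by rewrite e1.
  by rewrite -mulmxA /Kp mulmxDl mul1mx KK addrC.
- have /submxP[X ->] : (E2 <= Km)%MS by rewrite e2.
  by rewrite -mulmxA /Km mulmxBl mul1mx KK -mulmxN opprB.
- by rewrite -row_full_unit -sub1mx -addsmxE (adds_eqmx e1 e2).
Qed.

Lemma calibrated_block (W : 'M[C]_(6, 7)) (D : 'M_6) :
  realmx W -> W *m sgn_mx 7 4 *m W^T = sgn_mx 6 3 -> realmx D ->
  (forall x y z, phi1 (x *m D *m W) (y *m W) (z *m W)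
     + phi1 (x *m W) (y *m D *m W) (z *m W) + phi1 (x *m W) (y *m W) (z *m D *m W) = 0) ->
  exists A B P, [/\ sl3 A, sl3 B, realmx P, P \in unitmx
    & P *m D = (block_mx A 0 0 B : 'M[C]_(3 + 3)) *m P].
Proof.
set E := sgn_mx 7 4; set S := sgn_mx 6 3 => rW gW rD inv.
have [n [rn nn nW comp]] := normal_exists rW gW.
have [J rJ JE] := cross_mx rn.
have SS : S *m S = 1%:M := @sgn_mxK C 6 3.
have uS : S \in unitmx by have [] := mulmx1_unit SS.
(* The cross product with [n] in the coordinates of [W], read off with the dual basis
   [E *m W^T *m S]. *)
pose K : 'M[C]_6 := W *m J *m E *m W^T *m S.
have nC x : eta7 n (cross n x) = 0 by rewrite eta7C eta_cross phi1_xyx.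
have KW : K *m W = W *m J.
  apply/row_matrixP=> i; rewrite [in RHS]row_mul JE [RHS]comp.
  by rewrite (eta7C _ n) nC scale0r subr0 -JE /K !row_mul.
have fW : row_free W by apply/row_freeP; exists (E *m W^T *m S); rewrite !mulmxA gW.
have KK : K *m K = 1%:M.
  apply: (row_free_inj fW) => /=; rewrite -mulmxA KW mulmxA KW mul1mx.
  apply/row_matrixP=> i; rewrite !row_mul !JE cross_cross nn.
  by rewrite rowE nW scale0r sub0r scaleN1r opprK.
have rK : realmx K.
  by do !apply: realmx_mul => //; try exact: realmx_sgn; apply: realmx_tr.
have skew : K *m S = - (S *m K^T).
  have -> : S *m K^T = (K *m S)^T by rewrite (trmx_mul K) sgn_mx_tr.
  rewrite /K -(mulmxA _ S S) SS mulmx1.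
  apply/matrixP=> i j; rewrite [RHS]mxE [in RHS]mxE !gram_entry !row_mul !JE.
  by rewrite !eta_cross phi1_skew23.
have [E1 [E2 [r1 r2 e1 e2 uP]]] := involution_eigenspaces (n := 3) rK KK uS skew.
pose P : 'M[C]_6 := (col_mx E1 E2 : 'M_(3 + 3, 6)).
have rP : realmx P by exact: (realmx_col (m := 3) (n := 3)).
pose D' : 'M[C]_(3 + 3) := P *m D *m invmx P.
have rD' : realmx D' by apply: realmx_mul; [apply: realmx_mul | apply: realmx_inv].
have PD : P *m D = D' *m P by rewrite /D' mulmxKV.
pose A := ulsubmx D'; pose X := ursubmx D'; pose Z := dlsubmx D'; pose B := drsubmx D'.
have D'E : D' = block_mx A X Z B by rewrite submxK.
have [E1D E2D] : E1 *m D = A *m E1 + X *m E2 /\ E2 *m D = Z *m E1 + B *m E2.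
  by apply: eq_col_mx; rewrite -mul_block_col -mul_col_mx -D'E; apply: PD.
pose Y1 := E1 *m W; pose Y2 := E2 *m W.
have n1 a : eta7 n (a *m Y1) = 0 by rewrite mulmxA nW.
have n2 a : eta7 n (a *m Y2) = 0 by rewrite mulmxA nW.
have c1 a : cross n (a *m Y1) = a *m Y1.
  by rewrite -JE -!mulmxA -KW (mulmxA E1) e1.
have c2 a : cross n (a *m Y2) = - (a *m Y2).
  by rewrite -JE -!mulmxA -KW (mulmxA E2) e2 mulNmx mulmxN.
have phi1Nm x y z : phi1 x (- y) z = - phi1 x y z :> C.
  by rewrite -scaleN1r phi1Zm mulN1r.
(* Moving the cross product from [a] to [b] changes the eigenvalue from [1] to [-1], so twice the
   value is zero. *)
have mix a b w : eta7 n w = 0 -> phi1 (a *m Y1) (b *m Y2) w = 0.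
  move=> nw; have := phi1_cross n (a *m Y1) (b *m Y2) w.
  rewrite c1 c2 phi1Nm n1 n2 nw !mul0r mulr0 subr0 addr0 opprK -mulr2n => /eqP.
  by rewrite mulrn_eq0 => /eqP.
have mix' a b w : eta7 n w = 0 -> phi1 (a *m Y2) (b *m Y1) w = 0.
  by move=> nw; rewrite phi1_skew12 mix ?oppr0.
have m121 a b d : phi1 (a *m Y1) (b *m Y2) (d *m Y1) = 0 by apply: mix.
have m122 a b d : phi1 (a *m Y1) (b *m Y2) (d *m Y2) = 0 by apply: mix.
have m211 a b d : phi1 (a *m Y2) (b *m Y1) (d *m Y1) = 0 by apply: mix'.
have m212 a b d : phi1 (a *m Y2) (b *m Y1) (d *m Y2) = 0 by apply: mix'.
have m112 a b d : phi1 (a *m Y1) (b *m Y1) (d *m Y2) = 0 by rewrite phi1_skew23 m121 oppr0.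
have m221 a b d : phi1 (a *m Y2) (b *m Y2) (d *m Y1) = 0 by rewrite phi1_skew23 m212 oppr0.
have mE := (m121, m122, m211, m212, m112, m221).
have dec y : exists a b, y = a *m Y1 + b *m Y2 - eta7 y n *: n.
  pose u : 'rV[C]_(3 + 3) := y *m E *m W^T *m S *m invmx P.
  exists (lsubmx u), (rsubmx u); rewrite !mulmxA -mulmxDl -mul_row_col hsubmxK.
  by rewrite {1}(comp y) /u mulmxKV.
have dec' y : exists a b, y = a *m Y2 + b *m Y1 - eta7 y n *: n.
  by have [a [b e]] := dec y; exists b, a; rewrite (addrC (b *m _)).
have deg1 := phi1_block_nondegenerate dec mix n1 n2.
have deg2 := phi1_block_nondegenerate dec' mix' n2 n1.
have f1 a : a *m Y1 = 0 -> a = 0.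
  rewrite mulmxA -[0](mul0mx _ W) => /(row_free_inj fW) e.
  have : row_mx a 0 *m col_mx E1 E2 = 0 *m col_mx E1 E2.
    by rewrite mul_row_col mul0mx addr0 mul0mx.
  by move/(can_inj (mulmxK uP)); rewrite -row_mx0 => /eq_row_mx[].
have f2 a : a *m Y2 = 0 -> a = 0.
  rewrite mulmxA -[0](mul0mx _ W) => /(row_free_inj fW) e.
  have : row_mx 0 a *m col_mx E1 E2 = 0 *m col_mx E1 E2.
    by rewrite mul_row_col mul0mx add0r mul0mx.
  by move/(can_inj (mulmxK uP)); rewrite -row_mx0 => /eq_row_mx[].
have D1 a : a *m E1 *m D *m W = a *m A *m Y1 + a *m X *m Y2.
  by rewrite -(mulmxA a E1) E1D mulmxDr mulmxDl !mulmxA.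
have D2 a : a *m E2 *m D *m W = a *m Z *m Y1 + a *m B *m Y2.
  by rewrite -(mulmxA a E2) E2D mulmxDr mulmxDl !mulmxA.
(* With one argument in the first eigenspace and two in the second, only the component through [X]
   is unmixed; nondegeneracy then kills it. *)
have X0 : X = 0.
  apply/row_matrixP=> i; rewrite row0 rowE; apply: f2; apply: deg2 => a b.
  have := inv (delta_mx 0 i *m E1) (a *m E2) (b *m E2).
  rewrite D1 !D2 -!(mulmxA _ _ W) -/Y1 -/Y2 !phi1Dl !phi1Dm !phi1Dr.
  by rewrite !mE !add0r !addr0.
have Z0 : Z = 0.
  apply/row_matrixP=> i; rewrite row0 rowE; apply: f1; apply: deg1 => a b.
  have := inv (delta_mx 0 i *m E2) (a *m E1) (b *m E1).
  rewrite D2 !D1 -!(mulmxA _ _ W) -/Y1 -/Y2 !phi1Dl !phi1Dm !phi1Dr.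
  by rewrite !mE !addr0.
rewrite X0 Z0 in D'E.
have [rA rB] : realmx A /\ realmx B by apply: (realmx_block (B := 0) (D := 0)); rewrite -D'E.
(* Invariance makes [\tr A] times the volume of the eigenspace zero, and a zero volume would
   contradict nondegeneracy. *)
have trA : \tr A = 0.
  have /phi1_row3_trace/eqP : forall u v w, phi1 (u *m A *m Y1) (v *m Y1) (w *m Y1)
     + phi1 (u *m Y1) (v *m A *m Y1) (w *m Y1) + phi1 (u *m Y1) (v *m Y1) (w *m A *m Y1) = 0.
    move=> u v w; have := inv (u *m E1) (v *m E1) (w *m E1).
    by rewrite !D1 X0 !mulmx0 !mul0mx !addr0 -!(mulmxA _ _ W).
  rewrite mulf_eq0 => /orP[/eqP t0|/eqP//].
  have /deg1/f1 : forall a b, phi1 ((delta_mx 0 0 : 'rV_3) *m Y1) (a *m Y1) (b *m Y1) = 0.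
    by move=> a b; rewrite phi1_row3 t0 mul0r.
  by move/rowP/(_ 0)/eqP; rewrite !mxE !eqxx oner_eq0.
have trB : \tr B = 0.
  have /phi1_row3_trace/eqP : forall u v w, phi1 (u *m B *m Y2) (v *m Y2) (w *m Y2)
     + phi1 (u *m Y2) (v *m B *m Y2) (w *m Y2) + phi1 (u *m Y2) (v *m Y2) (w *m B *m Y2) = 0.
    move=> u v w; have := inv (u *m E2) (v *m E2) (w *m E2).
    by rewrite !D2 Z0 !mulmx0 !mul0mx !add0r -!(mulmxA _ _ W).
  rewrite mulf_eq0 => /orP[/eqP t0|/eqP//].
  have /deg2/f2 : forall a b, phi1 ((delta_mx 0 0 : 'rV_3) *m Y2) (a *m Y2) (b *m Y2) = 0.
    by move=> a b; rewrite phi1_row3 t0 mul0r.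
  by move/rowP/(_ 0)/eqP; rewrite !mxE !eqxx oner_eq0.
by exists A, B, P; split=> //; rewrite -D'E.
Qed.

End Core.

(** * The equivalence *)

Section Equiv.
Variables (C : numClosedFieldType) (c : 'I_7 -> 'I_7 -> 'rV[C]_7).
Variable U : 'M[C]_(6, 7).
Hypotheses (lie : is_real_lie_algebra c) (abU : is_abelian_ideal6 c U).

Lemma bracketDl x y z : bracket c (x + y) z = bracket c x z + bracket c y z.
Proof.
rewrite /bracket -big_split; apply: eq_bigr => i _; rewrite -big_split /=.
by apply: eq_bigr => j _; rewrite mxE mulrDl scalerDl.
Qed.

Lemma bracketZl k x z : bracket c (k *: x) z = k *: bracket c x z.
Proof.
rewrite /bracket scaler_sumr; apply: eq_bigr => i _; rewrite scaler_sumr.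
by apply: eq_bigr => j _; rewrite mxE scalerA mulrA.
Qed.

Lemma bracket_skew x y : realmx x -> realmx y -> bracket c y x = - bracket c x y.
Proof.
move=> rx ry; case: lie => _ [xx _]; apply/eqP; rewrite -addr_eq0; apply/eqP.
have rxy : realmx (x + y) by move=> i j; rewrite mxE rpredD.
have := xx _ rxy; rewrite bracketDl !bracketE !mulmxDl -!bracketE !xx //.
by rewrite addr0 add0r addrC.
Qed.

(** A vector is a complex combination of its real and imaginary parts. This extends closedness,
    which is assumed on real vectors only, to the complex vectors on which [calibrated_block]
    works. *)
Lemma real_linear_eq0 n (f : 'rV[C]_n -> C) :
  (forall k x y, f (k *: x + y) = k * f x + f y) ->
  (forall x, realmx x -> f x = 0) -> forall x, f x = 0.
Proof.
move=> lf f0 x.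
have -> : x = 'i *: (map_mx (fun z => 'Im z) x) + map_mx (fun z => 'Re z) x.
  by apply/rowP=> j; rewrite !mxE addrC -Crect.
by rewrite lf !f0 ?mulr0 ?addr0 // => i j; rewrite mxE ?Creal_Re ?Creal_Im.
Qed.

Lemma i_ii : cond_i c U -> cond_ii c U.
Proof.
case=> F [rF uF closed [_ [[P [rP uP ->]] gram]]]; apply/(cond_iiE abU) => f D rf nf De.
have rU := ideal_real abU.
have rD : realmx D.
  have [D' rD' e] := ad_ideal abU rf.
  by have := row_free_inj (ideal_free abU) (etrans (esym De) e) => ->.
pose DB := P *m D *m invmx P.
have rDB : realmx DB by apply: realmx_mul; [apply: realmx_mul | apply: realmx_inv].
have Bad : P *m U *m ad_mx c f = DB *m (P *m U).
  by rewrite -mulmxA De !mulmxA mulmxKV.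
have rB : realmx (P *m U) by apply: realmx_mul.
have inB x : realmx x -> in_span U (x *m (P *m U)).
  by move=> rx; exists (x *m P); split; [apply: realmx_mul | rewrite mulmxA].
have abel x y : realmx x -> realmx y -> bracket c (x *m (P *m U)) (y *m (P *m U)) = 0.
  by move=> rx ry; case: abU => _ _ _; apply; apply: inB.
have adB x : bracket c f (x *m (P *m U)) = x *m DB *m (P *m U).
  by rewrite bracketE -mulmxA Bad mulmxA.
pose W := P *m U *m F.
have rW : realmx W by apply: realmx_mul.
have gW : W *m sgn_mx 7 4 *m W^T = sgn_mx 6 3.
  apply/matrixP=> k l; rewrite gram_entry !row_mul -!row_mul /W !row_mul.
  have := gram k l; rewrite /gF !row_mul => ->.
  by rewrite !mxE; case: (k == l).
pose T x y z := phi1 (x *m DB *m W) (y *m W) (z *m W)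
     + phi1 (x *m W) (y *m DB *m W) (z *m W) + phi1 (x *m W) (y *m W) (z *m DB *m W).
have T0 x y z : realmx x -> realmx y -> realmx z -> T x y z = 0.
  move=> rx ry rz.
  have rxB (u : 'rV_6) : realmx u -> realmx (u *m (P *m U)) by move=> ru; apply: realmx_mul.
  (* Brackets inside the ideal vanish, so [d3] on [f] and three vectors of the ideal is minus the
     derivation action of [DB] on the form. *)
  have := closed f (x *m (P *m U)) (y *m (P *m U)) (z *m (P *m U))
    rf (rxB _ rx) (rxB _ ry) (rxB _ rz).
  rewrite /d3 !abel // !adB /phiF !mul0mx !phi1_0l !subr0 addr0 -!(mulmxA _ (P *m U) F) -/W.
  rewrite (phi1_skew12 (x *m W)) (phi1_skew12 (x *m W) (z *m DB *m W))
    (phi1_skew23 _ (y *m W) (z *m DB *m W)) opprK => e.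
  by rewrite /T -[LHS]opprK -[RHS]oppr0 -e; congr (- _); ring.
have T0' x y z : T x y z = 0.
  move: x; apply: real_linear_eq0 => [k x x'|x rx].
    by rewrite /T !mulmxDl -!scalemxAl !phi1E; ring.
  move: y; apply: real_linear_eq0 => [k y y'|y ry].
    by rewrite /T !mulmxDl -!scalemxAl !phi1E; ring.
  move: z; apply: real_linear_eq0 => [k z z'|z rz]; last exact: T0.
  by rewrite /T !mulmxDl -!scalemxAl !phi1E; ring.
have [A [B [Q [sA sB rQ uQ e]]]] := calibrated_block rW gW rDB T0'.
exists A, B, (Q *m P); split=> //; first exact: realmx_mul.
  by rewrite unitmx_mul uQ.
have PD : P *m D = DB *m P by rewrite mulmxKV.
by rewrite -mulmxA PD mulmxA e mulmxA.
Qed.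

(** Every bracket is a combination of values of [D] weighted by [f]-components, so [d3] is
    determined by the action of [D] on the form restricted to the ideal. *)
Lemma derivation_closed F B f (D : 'M[C]_6) :
  ordered_basis_of U B -> realmx f -> (col_mx B f : 'M_(6 + 1, 7)) \in (@unitmx C 7) ->
  B *m ad_mx c f = D *m B ->
  (forall x y z, phiF F (x *m D *m B) (y *m B) (z *m B)
     + phiF F (x *m B) (y *m D *m B) (z *m B) + phiF F (x *m B) (y *m B) (z *m D *m B) = 0) ->
  forall x0 x1 x2 x3, realmx x0 -> realmx x1 -> realmx x2 -> realmx x3 ->
  d3 c (phiF F) x0 x1 x2 x3 = 0.
Proof.
move=> [P [rP uP BE]] rf uG BD inv x0 x1 x2 x3 r0 r1 r2 r3.
have rB : realmx B by rewrite BE; apply: realmx_mul => //; apply: ideal_real abU.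
have dec x : realmx x -> exists u s, [/\ realmx u, s \is Num.real & x = u *m B + s *: f].
  move=> rx; pose a : 'rV[C]_(6 + 1) := x *m invmx (col_mx B f : 'M_7).
  have ra : realmx a.
    by apply: realmx_mul => //; apply: realmx_inv; apply: (realmx_col (m := 6) (n := 1)).
  exists (lsubmx a), (rsubmx a 0 0); split.
  - by move=> i j; rewrite mxE.
  - by rewrite mxE.
  by rewrite -mul_scalar_mx -mx11_scalar -mul_row_col hsubmxK mulmxKV.
have adB u : bracket c f (u *m B) = u *m D *m B by rewrite bracketE -mulmxA BD mulmxA.
have brE u s u' s' : realmx u -> s \is Num.real -> realmx u' -> s' \is Num.real ->
    bracket c (u *m B + s *: f) (u' *m B + s' *: f)
    = s *: (u' *m D *m B) + (- s') *: (u *m D *m B).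
  move=> ru rs ru' rs'.
  have rBu (v : 'rV_6) : realmx v -> realmx (v *m B) by move=> rv; apply: realmx_mul.
  have inB v : realmx v -> in_span U (v *m B).
    by move=> rv; exists (v *m P); split; [apply: realmx_mul | rewrite BE mulmxA].
  have ab : bracket c (u *m B) (u' *m B) = 0.
    by case: abU => _ _ _; apply; apply: inB.
  have ff : bracket c f f = 0 by case: lie => _ [xx _]; apply: xx.
  rewrite bracketDl bracketZl bracketE mulmxDl -scalemxAl -!bracketE ab add0r.
  rewrite (bracket_skew rf (rBu _ ru)) [bracket c f (_ + _)]bracketE.
  rewrite mulmxDl -scalemxAl -!bracketE ff.
  by rewrite scaler0 addr0 !adB scalerN -scaleNr addrC.
have [u0 [s0 [ru0 rs0 ->]]] := dec _ r0; have [u1 [s1 [ru1 rs1 ->]]] := dec _ r1.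
have [u2 [s2 [ru2 rs2 ->]]] := dec _ r2; have [u3 [s3 [ru3 rs3 ->]]] := dec _ r3.
rewrite /d3 !brE // /phiF !mulmxDl -!scalemxAl.
pose w (u : 'rV[C]_6) := u *m D *m B *m F; pose v (u : 'rV[C]_6) := u *m B *m F; pose g := f *m F.
pose H x y z := phi1 (w x) (v y) (v z) - phi1 (w y) (v x) (v z) + phi1 (w z) (v x) (v y).
have H0 x y z : H x y z = 0.
  rewrite -(inv x y z) /H /phiF /w /v (phi1_skew12 _ (x *m B *m F)).
  by rewrite (phi1_skew23 (x *m B *m F)) (phi1_skew12 _ (x *m B *m F)) !opprK.
rewrite -/(w u0) -/(w u1) -/(w u2) -/(w u3) -/(v u0) -/(v u1) -/(v u2) -/(v u3) -/g.
(* The terms containing [g] cancel by antisymmetry. Each remaining group pairs the [f]-component of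
   one argument with the action of [D] on the other three. *)
transitivity (- s0 * H u1 u2 u3 + s1 * H u0 u2 u3 - s2 * H u0 u1 u3 + s3 * H u0 u1 u2);
  last by rewrite !H0 !mulr0 subr0 !addr0.
rewrite /H !phi1E !phi1_xyy !(phi1_skew23 _ g).
ring.
Qed.

End Equiv.

(** * A null frame for the model *)

Section Frame.
Variable C : numClosedFieldType.

(* [isotropic (-1)] and [isotropic 1] are the two isotropic three-spaces in the
   orthogonal of [e_1] on which the cross product with [e_1] is [1] and [-1]. *)
Definition isotropic (s : C) : 'M[C]_(3, 7) :=
  \matrix_(i, j) nth 0 (nth [::] [:: [:: 0; 1; 0; 0; 0; 0; s];
    [:: 0; 0; 1; 0; - s; 0; 0]; [:: 0; 0; 0; 1; 0; s; 0]] i) j.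

Lemma isotropicE s (a : 'rV[C]_3) : let x k := (a *m isotropic s) 0 (ix k) in
  (((x 1 = 0)%R * (x 2 = a 0 0)%R * (x 3 = a 0 1)%R * (x 4 = a 0 2%:R)%R
  * (x 5 = - s * a 0 1)%R * (x 6 = s * a 0 2%:R)%R * (x 7 = s * a 0 0)%R))%type.
Proof. by rewrite /=; do 6?[split]; rewrite mul_rV3 !mxE !ixK //=; ring. Qed.

Lemma isotropic_gram s t :
  isotropic s *m (isotropic t)^T = (1 + s * t)%:M.
Proof.
apply/matrixP=> -[[|[|[|//]]] ?] [[|[|[|//]]] ?]; rewrite mxE big_ix !mxE !ixK //=; ring.
Qed.

Lemma isotropic_gram_eta s t :
  isotropic s *m sgn_mx 7 4 *m (isotropic t)^T = (s * t - 1)%:M.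
Proof.
apply/matrixP=> i j; rewrite gram_entry eta7E.
case: i => -[|[|[|//]]] ?; case: j => -[|[|[|//]]] ?; rewrite !mxE !ixK //=; ring.
Qed.

Lemma isotropic_mixed s (a b d : 'rV[C]_3) : s = 1 \/ s = -1 ->
  phi1 (a *m isotropic s) (b *m isotropic (- s)) (d *m isotropic s) = 0.
Proof. by case=> ->; rewrite /phi1 !e3E !isotropicE; ring. Qed.

Definition null_frame : 'M[C]_(3 + 3, 7) := col_mx (isotropic (-1)) (isotropic 1).

(** Two-by-two matrices acting on pairs of three-vectors. *)
Definition scalar_block (a b c d : C) : 'M[C]_(3 + 3) := block_mx a%:M b%:M c%:M d%:M.

Lemma scalar_blockM a b c d a' b' c' d' :
  scalar_block a b c d *m scalar_block a' b' c' d'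
  = scalar_block (a * a' + b * c') (a * b' + b * d') (c * a' + d * c') (c * b' + d * d').
Proof. by rewrite /scalar_block mulmx_block -!scalar_mxM -!raddfD. Qed.

Lemma scalar_block1 : scalar_block 1 0 0 1 = 1%:M.
Proof. by rewrite /scalar_block !raddf0 -scalar_mx_block. Qed.

Lemma scalar_block_sgn : scalar_block (-1) 0 0 1 = sgn_mx 6 3.
Proof.
apply/matrixP=> i j; rewrite /scalar_block.
case: (split_ordP (i : 'I_(3 + 3))) => i' ->; case: (split_ordP (j : 'I_(3 + 3))) => j' ->;
  rewrite ?(block_mxEul, block_mxEur, block_mxEdl, block_mxEdr) !mxE /=.
- by rewrite ltn_ord.
- by rewrite mul0rn -val_eqE /= ltn_eqF ?(leq_trans (ltn_ord i')) ?leq_addr.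
- by rewrite mul0rn eq_sym -val_eqE /= ltn_eqF ?(leq_trans (ltn_ord j')) ?leq_addr.
- by rewrite (inj_eq (@rshift_inj 3 3)).
Qed.

(** Half the sum and half the difference of paired null vectors. On [null_frame] it yields e_2, e_3,
    e_4, of norm -1, and then -e_7, e_5, -e_6, of norm 1. *)
Definition half_reflection : 'M[C]_(3 + 3) :=
  scalar_block 2%:R^-1 2%:R^-1 2%:R^-1 (- 2%:R^-1).

Lemma realmx_half_reflection : realmx half_reflection.
Proof.
apply/realmxP; rewrite /half_reflection /scalar_block map_block_mx !map_scalar_mx.
by rewrite /= rmorphN !fmorphV rmorph_nat.
Qed.

Lemma half_reflection_unit : half_reflection \in unitmx.
Proof.
have [] // := mulmx1_unit (A := half_reflection) (B := scalar_block 1 1 1 (-1)) _.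
by rewrite scalar_blockM -scalar_block1; congr scalar_block; field.
Qed.

Lemma half_reflection_gram :
  half_reflection *m null_frame *m sgn_mx 7 4 *m (half_reflection *m null_frame)^T
  = sgn_mx 6 3.
Proof.
have gN : null_frame *m sgn_mx 7 4 *m null_frame^T = scalar_block 0 (- 2%:R) (- 2%:R) 0.
  rewrite /null_frame gram_col !isotropic_gram_eta /scalar_block.
  by congr block_mx; congr (_%:M); ring.
have tr : half_reflection^T = half_reflection.
  by rewrite /half_reflection /scalar_block tr_block_mx !tr_scalar_mx.
rewrite trmx_mul tr -!(mulmxA half_reflection) (mulmxA (null_frame *m _)) gN mulmxA.
rewrite /half_reflection !scalar_blockM -scalar_block_sgn.
by congr scalar_block; field.
Qed.

Definition frame : 'M[C]_7 := (col_mx null_frame (delta_mx 0 0) : 'M_(6 + 1, 7)).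

Lemma realmx_frame : realmx frame.
Proof.
have r1 s : s \is Num.real -> realmx (isotropic s).
  by move=> rs i j; rewrite mxE; case: i => -[|[|[|//]]] ? /=;
    case: j => -[|[|[|[|[|[|[|//]]]]]]] ? /=; rewrite ?rpredN ?real0 ?real1.
apply: (realmx_col (m := 6) (n := 1)).
  by apply: (realmx_col (m := 3) (n := 3)); apply: r1; rewrite ?rpredN real1.
by move=> i j; rewrite mxE; case: (_ && _); rewrite ?real0 ?real1.
Qed.

(** The Euclidean Gram matrix of the frame is diagonal, with entries 2 on the null vectors and 1 on
    e_1. *)
Lemma frame_unit : frame \in unitmx.
Proof.
have nE s : isotropic s *m (delta_mx 0 0 : 'rV_7)^T = 0.
  by rewrite trmx_delta -colE; apply/colP=> -[[|[|[|//]]] ?]; rewrite !mxE.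
have gN : null_frame *m null_frame^T = (2%:R)%:M.
  rewrite -{1}[null_frame]mulmx1 gram_col !mulmx1 !isotropic_gram.
  rewrite !(mulrNN, mulN1r, mulr1, mul1r) subrr raddf0.
  by rewrite -[1 + 1]/(2%:R) -scalar_mx_block.
have Nn : null_frame *m (delta_mx 0 0 : 'rV_7)^T = 0.
  by rewrite mul_col_mx !nE col_mx0.
have nN : delta_mx 0 0 *m null_frame^T = 0 :> 'rV_6.
  by rewrite -[LHS]trmxK trmx_mul trmxK Nn trmx0.
have ee : (delta_mx 0 0 : 'rV[C]_7) *m (delta_mx 0 0)^T = 1%:M.
  by rewrite trmx_delta mul_delta_mx; apply/matrixP=> i j; rewrite !ord1 !mxE.
have g : frame *m 1%:M *m frame^T = block_mx (2%:R)%:M 0 0 1%:M :> 'M_(6 + 1).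
  by rewrite (gram_col null_frame (delta_mx 0 0 : 'rV_7)) !mulmx1 gN Nn nN ee.
have : \det (frame *m 1%:M *m frame^T) != 0.
  rewrite g (det_ublock (n1 := 6) (n2 := 1)) !det_scalar expr1n mulr1.
  by rewrite expf_neq0 ?pnatr_eq0.
by rewrite mulmx1 det_mulmx mulf_eq0 negb_or unitmxE unitfE => /andP[].
Qed.

End Frame.

(** * From the block form to a calibrated form *)

Section Converse.
Variables (C : numClosedFieldType) (c : 'I_7 -> 'I_7 -> 'rV[C]_7).
Variable U : 'M[C]_(6, 7).
Hypotheses (lie : is_real_lie_algebra c) (abU : is_abelian_ideal6 c U).

Lemma basis_completion (B : 'M[C]_(6, 7)) f :
  ordered_basis_of U B -> realmx f -> ~ in_span U f ->
  (col_mx B f : 'M_(6 + 1, 7)) \in (@unitmx C 7).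
Proof.
move=> [P [rP uP ->]] /realmxP rf nf; rewrite unitmxE unitfE; apply/det0P=> -[v nzv vG].
pose a : 'rV[C]_6 := lsubmx (v : 'rV_(6 + 1)).
pose t : 'rV[C]_1 := rsubmx (v : 'rV_(6 + 1)).
have {vG} : a *m (P *m U) + t *m f = 0 by rewrite -vG -(mul_row_col a t) hsubmxK.
have fPU : row_free (P *m U).
  by rewrite /row_free mxrankMfree ?(ideal_free abU) // mxrank_unit.
rewrite [t]mx11_scalar mul_scalar_mx; have [t0|nzt] := eqVneq (t 0 0) 0.
  rewrite t0 scale0r addr0 -[0](mul0mx _ (P *m U)) => /(row_free_inj fPU) a0.
  move: nzv; rewrite -[v](hsubmxK (v : 'rV_(6 + 1))) -/a -/t a0 [t]mx11_scalar t0.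
  by rewrite raddf0 row_mx0 eqxx.
move/eqP; rewrite addrC addr_eq0 => /eqP e; apply: nf.
have {}e : f = (- (t 0 0)^-1 *: a *m P) *m U.
  by rewrite -mulmxA -scalemxAl scaleNr -scalerN -e scalerA mulVf // scale1r.
exists (- (t 0 0)^-1 *: a *m P); split=> //.
(* [in_span] asks for real coefficients, whereas [v] was only complex; they are real because [U] is
   real and free and [f] is real. *)
by apply: realmx_free (ideal_free abU) (ideal_real abU) _; rewrite -e; apply/realmxP.
Qed.

Lemma outside_ideal : exists2 f : 'rV[C]_7, realmx f & ~ in_span U f.
Proof.
have [i nsub | sub] := pickP (fun i : 'I_7 => ~~ ((delta_mx 0 i : 'rV[C]_7) <= U)%MS).
  exists (delta_mx 0 i) => [k l | [a [_ e]]].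
    by rewrite mxE; case: (_ && _); rewrite ?real0 ?real1.
  by move: nsub; rewrite e submxMl.
have : ((1%:M : 'M[C]_7) <= U)%MS.
  by apply/row_subP=> i; rewrite rowE mulmx1; apply/negbFE/sub.
move/mxrankS; rewrite mxrank1; case: abU => _ -> _ _ //.
Qed.

Lemma ii_i : cond_ii c U -> cond_i c U.
Proof.
move=> /(cond_iiE abU) ii.
have [f rf nf] := outside_ideal.
have [D rD De] := ad_ideal abU rf.
have [A [B [P [[rA tA] [rB tB] rP uP e]]]] := ii f D rf nf De.
pose Bs := P *m U.
have bBs : ordered_basis_of U Bs by exists P.
pose G : 'M[C]_7 := (col_mx Bs f : 'M_(6 + 1, 7)).
have uG : G \in unitmx := basis_completion bBs rf nf.
have rG : realmx G.
  apply: (realmx_col (m := 6) (n := 1)) => //.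
  by apply: realmx_mul => //; apply: ideal_real abU.
(* [F] sends the adapted basis to the null frame and [f] to e_1, so [A] and [B] act on the two
   isotropic three-spaces. *)
pose F := invmx G *m frame C.
have BF : Bs *m F = null_frame C.
  have : G *m F = frame C by rewrite mulKVmx.
  rewrite /G (mul_col_mx Bs f F) => GF.
  by have [] := eq_col_mx (GF : _ = col_mx (null_frame C) (delta_mx 0 0)).
pose M : 'M[C]_(3 + 3) := block_mx A 0 0 B.
have BsD : Bs *m ad_mx c f = M *m Bs by rewrite -mulmxA De mulmxA e mulmxA.
exists F; split.
- by apply: realmx_mul; [apply: realmx_inv | apply: realmx_frame].
- by rewrite unitmx_mul unitmx_inv uG frame_unit.
- apply: (derivation_closed lie abU bBs rf uG BsD) => x y z.
  rewrite /phiF -!(mulmxA _ Bs F) BF.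
  pose Y1 : 'M[C]_(3, 7) := isotropic (-1); pose Y2 : 'M[C]_(3, 7) := isotropic 1.
  have split6 (u : 'rV[C]_(3 + 3)) : u *m null_frame C = lsubmx u *m Y1 + rsubmx u *m Y2.
    by rewrite -{1}[u]hsubmxK mul_row_col.
  have splitM (u : 'rV[C]_(3 + 3)) :
      u *m M *m null_frame C = lsubmx u *m A *m Y1 + rsubmx u *m B *m Y2.
    rewrite -{1}[u]hsubmxK /M mul_row_block !mulmx0 addr0 add0r.
    by rewrite mul_row_col.
  have m121 a b d : phi1 (a *m Y1) (b *m Y2) (d *m Y1) = 0.
    by rewrite /Y2 -[1]opprK isotropic_mixed; auto.
  have m212 a b d : phi1 (a *m Y2) (b *m Y1) (d *m Y2) = 0.
    by rewrite isotropic_mixed; auto.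
  have m112 a b d : phi1 (a *m Y1) (b *m Y1) (d *m Y2) = 0 by rewrite phi1_skew23 m121 oppr0.
  have m221 a b d : phi1 (a *m Y2) (b *m Y2) (d *m Y1) = 0 by rewrite phi1_skew23 m212 oppr0.
  have m211 a b d : phi1 (a *m Y2) (b *m Y1) (d *m Y1) = 0 by rewrite phi1_skew12 m121 oppr0.
  have m122 a b d : phi1 (a *m Y1) (b *m Y2) (d *m Y2) = 0 by rewrite phi1_skew12 m212 oppr0.
  rewrite !splitM !split6 !phi1E !(m121, m212, m112, m221, m211, m122) !add0r !addr0.
  have sum3 (p q r p' q' r' : C) : p + q + r = 0 -> p' + q' + r' = 0 ->
      p + p' + (q + q') + (r + r') = 0.
    by move=> e1 e2; transitivity ((p + q + r) + (p' + q' + r')); [ring | rewrite e1 e2 addr0].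
  (* Only the two volume forms remain, and each is annihilated by its trace-free block. *)
  by apply: sum3; [apply: (proj2 (phi1_row3_trace _ A)) | apply: (proj2 (phi1_row3_trace _ B))];
    rewrite ?tA ?tB mulr0.
(* The adapted basis is null for the metric; the half-reflection makes it orthonormal with signature
   (3,3). *)
exists (half_reflection C *m P *m U); split.
  exists (half_reflection C *m P); split=> //.
    by apply: realmx_mul => //; apply: realmx_half_reflection.
  by rewrite unitmx_mul half_reflection_unit.
have HF : half_reflection C *m P *m U *m F = half_reflection C *m null_frame C.
  by rewrite -BF !mulmxA.
move=> k l; rewrite /gF -!row_mul -gram_entry HF half_reflection_gram.
by rewrite !mxE; case: (k == l).
Qed.

End Converse.

Theorem theorem3p1 (C : numClosedFieldType) (c : 'I_7 -> 'I_7 -> 'rV[C]_7)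
  (U : 'M[C]_(6, 7)) :
  is_real_lie_algebra c -> is_abelian_ideal6 c U ->
  (cond_i c U <-> cond_ii c U) /\ (cond_ii c U <-> cond_iii c U).
Proof.
move=> lie abU; split; last exact: cond_ii_iii abU.
by split; [exact: i_ii | exact: ii_i].
Qed.
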